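(* A free ultrafilter on $\mathbb{N}$ is a UBP-filter if and only if it is semi-selective. Moreover, if $\mathcal{U}$ is a free ultrafilter on $\mathbb{N}$ and the uniform $\mathcal{U}$-boundedness principle holds for some infinite-dimensional Banach space $X$, then $\mathcal{U}$ is semi-selective.
   Context: $\mathbb{N}=\{0,1,2,\ldots\}$. A filter on $\mathbb{N}$ is a non-empty, upwards closed family $\mathcal{F}\subsetneq P(\mathbb{N})$ closed under finite intersections; it is free if it contains all cofinite subsets of $\mathbb{N}$. A set $A\subseteq\mathbb{N}$ is $\mathcal{F}$-stationary if $\mathbb{N}\setminus A\notin\mathcal{F}$. $(\forall_{\mathcal{F}}\, i\in\mathbb{N})\,\Phi(i)$ means $\{i\in\mathbb{N}:\Phi(i)\}\in\mathcal{F}$. $A\subseteq^* B$ means $A\setminus B$ is finite. For infinite $A\subseteq\mathbb{N}$, $\eta_A:\mathbb{N}\to A$ is the unique strictly increasing surjection. $\mathcal{F}$ is a P$^+$-filter if for every decreasing sequence $(A_k)_k$ of $\mathcal{F}$-stationary sets there is an $\mathcal{F}$-stationary set $B$ with $B\subseteq^* A_k$ for every $k$. $\mathcal{F}$ is a rapid$^+$ filter if for every $\mathcal{F}$-stationary set $I$ and every strictly increasing $f:\mathbb{N}\to\mathbb{N}$ there is an $\mathcal{F}$-stationary set $B\subseteq I$ with $f(n)\le\eta_B(n)$ for all $n$. A free ultrafilter is semi-selective if it is both a rapid$^+$ filter and a P$^+$-filter. For topological vector spaces $X,Y$, $\mathcal{L}(X,Y)$ is the space of continuous linear maps. A sequence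 $(y_i)_i$ in $Y$ is $\mathcal{F}$-bounded if for every $0$-neighbourhood $V$ in $Y$ there is $t>0$ with $ty_i\in V$ $(\forall_{\mathcal{F}}\, i\in\mathbb{N})$. A sequence $(T_i)_i$ in $\mathcal{L}(X,Y)$ is pointwise $\mathcal{F}$-bounded if $(T_i(x))_i$ is $\mathcal{F}$-bounded for every $x\in X$; it is $\mathcal{F}$-equicontinuous if for every $0$-neighbourhood $V$ in $Y$ there is a $0$-neighbourhood $U$ in $X$ with $T_i[U]\subseteq V$ $(\forall_{\mathcal{F}}\, i\in\mathbb{N})$. The uniform $\mathcal{F}$-boundedness principle holds for $X$ if for every locally convex space $Y$, every pointwise $\mathcal{F}$-bounded sequence in $\mathcal{L}(X,Y)$ is $\mathcal{F}$-equicontinuous. $\mathcal{F}$ is a UBP-filter if the uniform $\mathcal{F}$-boundedness principle holds for every Fréchet space $X$ (in the paper this is the same class as the filters for which it holds for every Banach space). *)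

(* Defs.v *)
From HB Require Import structures.
From mathcomp Require Import all_boot all_order all_algebra.
From mathcomp Require Import complex.
From mathcomp Require Import boolp classical_sets functions cardinality.
From mathcomp Require Import reals topology normedtype.

Set Implicit Arguments.
Unset Strict Implicit.
Unset Printing Implicit Defensive.

Import Order.TTheory GRing.Theory Num.Theory.
Import numFieldNormedType.Exports.

Local Open Scope classical_set_scope.
Local Open Scope ring_scope.

Section FiltersOnNat.
Implicit Types (F : set_system nat) (A B I : set nat).

Definition free_filter F := forall A, finite_set (~` A) -> F A.

Definition stationary F A := ~ F (~` A).

Definition almost_subset A B := finite_set (A `\` B).

Definition strictly_increasing (f : nat -> nat) :=
  {homo f : m n / (m < n)%N}.

(* Meaningful for infinite [A] only, where the selected function exists and is
   unique; for finite [A] it is the arbitrary default [id]. *)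
Definition eta A : nat -> nat :=
  xget (id : nat -> nat) [set e | strictly_increasing e /\ range e = A].

Definition P_plus F :=
  forall A : nat -> set nat,
    (forall k, stationary F (A k)) -> (forall k, A k.+1 `<=` A k) ->
    exists2 B, stationary F B & forall k, almost_subset B (A k).

(* [infinite_set B] is the condition under which [eta B] is defined; it is
   automatic for stationary sets of a free filter. *)
Definition rapid_plus F :=
  forall I (f : nat -> nat), stationary F I -> strictly_increasing f ->
    exists B, [/\ stationary F B, B `<=` I, infinite_set B
                & forall n, (f n <= eta B n)%N].

Definition semi_selective F :=
  [/\ UltraFilter F, free_filter F, rapid_plus F & P_plus F].

End FiltersOnNat.

(* [scalar_field R K] says that [K] is the field of real or complex numbers,
   [R] being the real numbers. *)
Inductive scalar_field (R : realType) : numFieldType -> Prop :=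
| real_scalars : scalar_field R R
| complex_scalars : scalar_field R R[i].

Section UniformBoundedness.
Context (K : numFieldType) (F : set_system nat).

Definition F_bounded (Y : topologicalLmodType K) (y : nat -> Y) :=
  forall V, nbhs (0 : Y) V ->
    exists2 t : K, 0 < t & \forall i \near F, V (t *: y i).

Definition pointwise_F_bounded (X Y : topologicalLmodType K)
    (T : nat -> {linear X -> Y}) :=
  forall x, F_bounded (fun i => T i x).

Definition F_equicontinuous (X Y : topologicalLmodType K)
    (T : nat -> {linear X -> Y}) :=
  forall V, nbhs (0 : Y) V ->
    exists2 U, nbhs (0 : X) U & \forall i \near F, T i @` U `<=` V.

(* [tvsType K] is the type of locally convex spaces over [K]. *)
Definition uniform_boundedness_principle (X : topologicalLmodType K) :=
  forall (Y : tvsType K) (T : nat -> {linear X -> Y}),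
    (forall i, continuous (T i)) ->
    pointwise_F_bounded T -> F_equicontinuous T.

End UniformBoundedness.

(* As for the norms and metrics of the library, distances are non-negative
   (hence real) elements of [K]. *)
Record complete_invariant_metric (K : numFieldType)
    (X : topologicalLmodType K) (d : X -> X -> K) : Prop := {
  cim_ge0 : forall x y, 0 <= d x y ;
  cim_eq0 : forall x y, d x y = 0 <-> x = y ;
  cim_sym : forall x y, d x y = d y x ;
  cim_triangle : forall x y z, d x z <= d x y + d y z ;
  cim_invariant : forall x y z, d (x + z) (y + z) = d x y ;
  cim_nbhs : forall x (A : set X),
    nbhs x A <-> exists2 e : K, 0 < e & [set y | d x y < e] `<=` A ;
  cim_complete : forall u : nat -> X,
    (forall e : K, 0 < e -> exists N, forall m n,
       (N <= m)%N -> (N <= n)%N -> d (u m) (u n) < e) ->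
    exists l : X, u @ \oo --> l }.

(* A Frechet space is a locally convex space whose topology is induced by a
   complete translation-invariant metric. Completeness is not taken from the
   uniform structure carried by a [tvsType], since the library only requires
   the latter to be compatible with the topology, not with translations. *)
Definition frechet (K : numFieldType) (X : tvsType K) :=
  exists d : X -> X -> K, complete_invariant_metric d.

Definition UBP_filter (K : numFieldType) (F : set_system nat) :=
  forall X : tvsType K, frechet X -> uniform_boundedness_principle F X.

Definition finite_dimensional (K : numFieldType) (X : lmodType K) :=
  exists (n : nat) (e : 'I_n -> X),
    forall x, exists c : 'I_n -> K, x = \sum_(i < n) c i *: e i.

(* Main.v *)
From HB Require Import structures.
Require Import Defs.
From mathcomp Require Import all_boot all_order all_algebra.
From mathcomp Require Import perm complex.
From mathcomp Require Import boolp classical_sets functions cardinality filter.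
From mathcomp Require Import reals topology normedtype sequences.
From mathcomp Require Import ring lra zify.

Set Implicit Arguments.
Unset Strict Implicit.
Unset Printing Implicit Defensive.

Import Order.TTheory GRing.Theory Num.Theory.
Import numFieldNormedType.Exports.

Local Open Scope classical_set_scope.
Local Open Scope ring_scope.

(* Let U be semi-selective and (T_i) pointwise U-bounded on a Frechet space but
   not U-equicontinuous. P+ and rapid+ give a set {c_0 < c_1 < ...} in U and
   vectors z_k, as small as wanted in terms of k, with T_{c_k} z_k large. For a
   random x = sum_k m_k z_k, with m_k uniform in {0, ..., 2^(k+2) - 1}, the
   vector T_{c_k} x is small with probability at most 2^-(k+2), whatever the
   other m_j are. So for some x it is large for all k, a contradiction.

   Conversely let the principle hold for an infinite-dimensional normed space
   and consider functionals; complex scalars reduce to real ones.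
   - If P+ failed, there would be k : nat -> nat tending to infinity along U
     such that no set of U is finite-to-one for k. By the Josefson-Nissenzweig
     theorem there are functionals phi_i with norms bounded below and
     phi_i x --> 0 for all x. For given x, the set of i such that
     |(k i + 1) phi_i x| > 1 is finite-to-one, so the functionals
     (k i + 1) phi_i are pointwise U-bounded, but they are not U-bounded.
   - If rapid+ failed, cut nat into long enough intervals I_n; on I_n take
     functionals psi_i of norm at least 1/4 with sum psi_i(x)^2 <= |x|^2. Then
     |(n + 1) psi_i x| > |x| for at most (n + 1)^2 of the i in I_n, so such i
     form a set which is too sparse to be in U.

   Proof of Josefson-Nissenzweig. Among the sequences of averages of tails of a
   bounded sequence of functionals choose one whose oscillation
   sup_{|x| <= 1} (limsup - liminf) cannot be decreased. If it is 0, the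
   sequence converges pointwise, hence it converges in norm or the differences
   with the limit are as required. If it is positive, a dyadic tree of
   subsequences oscillates like the Rademacher functions r_n; averaging along
   the tree against r_n gives functionals that are bounded below and, by
   Bessel's inequality, square summable at every x. So it remains to treat the
   case where all bounded sequences have averages converging in norm; there,
   functionals of norm at least 1/2, each vanishing on vectors that norm the
   averages of the previous ones, tend to 0 pointwise. *)

(** * Hahn-Banach *)

Record is_norm (R : realType) (V : lmodType R) (N : V -> R) : Prop := IsNorm {
  normD_le : forall x y, N (x + y) <= N x + N y ;
  normZ_eq : forall a x, N (a *: x) = `|a| * N x ;
  norm_eq0 : forall x, N x = 0 -> x = 0 }.

Definition dual_ball (R : realType) (V : lmodType R) (N : V -> R)
    (f : V -> R) :=
  (forall a x y, f (a *: x + y) = a * f x + f y) /\ forall x, `|f x| <= N x.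

Section HahnBanach.
Context (R : realType) (V : lmodType R) (N : V -> R) (hN : is_norm N).
Implicit Types (p q : V -> R) (x y z : V) (s t : R).

Definition sublinear p :=
  (forall x y, p (x + y) <= p x + p y) /\
  (forall t x, 0 <= t -> p (t *: x) <= t * p x).

Lemma sublinear0 p : sublinear p -> p 0 = 0.
Proof.
move=> [pD pZ]; have := pZ 0 0 (lexx 0); have := pD 0 0.
by rewrite scaler0 addr0 mul0r; lra.
Qed.

Lemma norm_ge0 x : 0 <= N x.
Proof.
have := normD_le hN x (- x); have := normZ_eq hN (-1) x; have := normZ_eq hN 0 x.
by rewrite scale0r scaleN1r subrr normrN1 normr0 mul0r => -> ->; lra.
Qed.

Lemma norm0 : N 0 = 0.
Proof. by rewrite -(scale0r 0) normZ_eq// normr0 mul0r. Qed.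

Lemma normN x : N (- x) = N x.
Proof. by rewrite -scaleN1r normZ_eq// normrN1 mul1r. Qed.

Lemma sublinear_norm : sublinear N.
Proof.
by split=> [x y|t x t0]; [exact: normD_le|rewrite normZ_eq// ger0_norm].
Qed.

Lemma sublinear_ge p x : sublinear p -> - p (- x) <= p x.
Proof.
by move=> sp; have := sublinear0 sp; have [pD _] := sp; have := pD x (- x);
  rewrite subrr; lra.
Qed.

(** At [y = - z] and [t = 1] the infimum is at most [- p z]: shrinking pushes [p] towards oddness
    along [z] and keeps it sublinear. *)
Definition shrink p z y := inf [set p (y + t *: z) - t * p z | t in [set t | 0 <= t]].

Lemma shrink_le p z y t : sublinear p -> 0 <= t ->
  shrink p z y <= p (y + t *: z) - t * p z.
Proof.
move=> sp t0; apply: ge_inf; last by exists t.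
exists (- p (- y)) => _ [s /= s0 <-]; have [pD pZ] := sp.
have := pD (y + s *: z) (- y); rewrite addrAC subrr add0r.
have [s_eq0|sn0] := eqVneq s 0.
  by have := sublinear0 sp; rewrite s_eq0 scale0r addr0; lra.
(* [sublinear] only bounds [p (s *: z)] from above; homogeneity with the factor [s^-1] gives the
   lower bound. *)
have := pZ s^-1 (s *: z); rewrite invr_ge0 => /(_ s0).
rewrite scalerA mulVf// scale1r => h.
have : s * p z <= s * (s^-1 * p (s *: z)) by rewrite ler_wpM2l.
rewrite mulrA divff// mul1r; lra.
Qed.

Lemma le_shrink p z y c :
  (forall t, 0 <= t -> c <= p (y + t *: z) - t * p z) -> c <= shrink p z y.
Proof.
move=> h; apply: lb_le_inf; first by exists (p (y + 0 *: z) - 0 * p z), 0 => /=.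
by move=> _ [t /= t0 <-]; exact: h.
Qed.

Lemma sublinear_shrink p z : sublinear p -> sublinear (shrink p z).
Proof.
move=> sp; have [pD pZ] := sp; split=> [x y|s x].
  rewrite -lerBlDl; apply: le_shrink => t t0.
  rewrite lerBlDl -lerBlDr; apply: le_shrink => s s0.
  have := shrink_le z (x + y) sp (addr_ge0 s0 t0).
  have := pD (x + s *: z) (y + t *: z).
  by rewrite addrACA -scalerDl mulrDl; lra.
rewrite le_eqVlt => /orP[/eqP<-|s0].
  by have := shrink_le z 0 sp (lexx 0); rewrite !scale0r addr0 !mul0r (sublinear0 sp) subr0.
rewrite mulrC -ler_pdivrMr//; apply: le_shrink => t t0; rewrite ler_pdivrMr//.
apply: le_trans (shrink_le _ _ sp (mulr_ge0 (ltW s0) t0)) _.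
by have := pZ s (x + t *: z) (ltW s0); rewrite scalerDr scalerA; lra.
Qed.

Lemma shrink_le_self p z y : sublinear p -> shrink p z y <= p y.
Proof.
by move=> sp; have := shrink_le z y sp (lexx 0); rewrite scale0r addr0 mul0r subr0.
Qed.

(* A minimal sublinear functional equals all its shrinkings, hence is
   superadditive. *)
Lemma minimal_sublinear_linear p : sublinear p ->
  (forall q, sublinear q -> (forall x, q x <= p x) -> q = p) ->
  forall a x y, p (a *: x + y) = a * p x + p y.
Proof.
move=> sp pmin; have [pD pZ] := sp.
have pDE x y : p (x + y) = p x + p y.
  apply/eqP; rewrite eq_le pD /=.
  have := shrink_le y x sp ler01.
  rewrite (pmin _ (sublinear_shrink y sp)); last by move=> ?; exact: shrink_le_self.
  by rewrite scale1r mul1r; lra.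
have pN x : p (- x) = - p x.
  by have := pDE x (- x); rewrite subrr (sublinear0 sp); lra.
have pZE a x : 0 <= a -> p (a *: x) = a * p x.
  move=> a0; apply/eqP; rewrite eq_le pZ//=.
  by have := pZ a (- x) a0; rewrite scalerN !pN; lra.
move=> a x y; rewrite pDE; congr (_ + _); have [a0|a0] := leP 0 a; first exact: pZE.
by rewrite -[a *: x]opprK -scaleNr pN pZE; lra.
Qed.

(** Zorn's lemma for the reversed pointwise order. The pointwise infimum of a non-empty chain is
    finite, because every member is at least [- p0 (- x)] at [x], and subadditive, because the
    smaller of two members serves for both arguments. *)
Lemma minimal_sublinear p0 : sublinear p0 ->
  exists p, [/\ sublinear p, (forall x, p x <= p0 x) &
    forall q, sublinear q -> (forall x, q x <= p x) -> q = p].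
Proof.
move=> sp0.
pose T := {p : V -> R | sublinear p /\ forall x, p x <= p0 x}.
pose r (p q : T) := `[< forall x, sval q x <= sval p x >].
have [|a b c /asboolP ab /asboolP bc|[a sa] [b sb] /asboolP ab /asboolP ba|A Atot|t tmax] :=
    @Zorn T r.
- by move=> t; apply/asboolP.
- by apply/asboolP => x; exact: le_trans (bc x) (ab x).
- by apply: eq_exist; apply/funext => x; apply/eqP; rewrite eq_le ab ba.
- have [[a0 Aa0]|A0] := pselect (exists a, A a); last first.
    exists (exist _ p0 (conj sp0 (fun=> lexx _))) => s As.
    by exfalso; apply: A0; exists s.
  pose q x := inf [set sval a x | a in A].
  have qle a x : A a -> q x <= sval a x.
    move=> Aa; apply: ge_inf; last by exists a.
    exists (- p0 (- x)) => _ [b Ab <-].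
    have [sb bp0] := svalP b; have := sublinear_ge x sb; have := bp0 (- x); lra.
  have qge x c : (forall a, A a -> c <= sval a x) -> c <= q x.
    move=> h; apply: lb_le_inf; first by exists (sval a0 x), a0.
    by move=> _ [b Ab <-]; exact: h.
  have sq : sublinear q.
    split=> [x y|s x].
      rewrite -lerBlDl; apply: (qge _) => a Aa; rewrite lerBlDl -lerBlDr.
      apply: (qge x) => b Ab; rewrite lerBlDr.
      have [ab|ab] := Atot _ _ Aa Ab; move/asboolP : ab => ab.
        apply: le_trans (qle _ _ Ab) _; have [[bD _] _] := svalP b.
        by have := bD x y; have := ab y; lra.
      apply: le_trans (qle _ _ Aa) _; have [[aD _] _] := svalP a.
      by have := aD x y; have := ab x; lra.
    rewrite le_eqVlt => /orP[/eqP<-|s0].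
      apply: le_trans (qle _ _ Aa0) _; have [sa _] := svalP a0.
      by rewrite scale0r mul0r (sublinear0 sa).
    rewrite mulrC -ler_pdivrMr//; apply: (qge _) => a Aa; rewrite ler_pdivrMr// mulrC.
    by apply: le_trans (qle _ _ Aa) _; have [[_ aZ] _] := svalP a; exact/aZ/ltW.
  have qp0 x : q x <= p0 x.
    by apply: le_trans (qle _ _ Aa0) _; have [_] := svalP a0; exact.
  by exists (exist _ q (conj sq qp0)) => s As; apply/asboolP => x; exact: qle.
- case: t tmax => p [sp pp0] pmin; exists p; split=> // q sq qp.
  have qp0 x : q x <= p0 x by apply: le_trans (qp x) (pp0 x).
  have e : exist _ q (conj sq qp0) = exist _ p (conj sp pp0) :> T by apply/pmin/asboolP.
  exact: (congr1 sval e).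
Qed.

(** A minimal sublinear [p] below [shrink N x] is linear, and the bound [shrink N x (- x) <= - N x]
    turns into [N x <= p x]. *)
Lemma norming_functional x : exists2 f, dual_ball N f & f x = N x.
Proof.
have [p [sp ple pmin]] := minimal_sublinear (sublinear_shrink x sublinear_norm).
have pL := minimal_sublinear_linear sp pmin.
have pN y : p (- y) = - p y.
  by have := pL (-1) y 0; rewrite scaleN1r !addr0 (sublinear0 sp) addr0 mulN1r.
have pleN y : p y <= N y.
  by apply: le_trans (ple y) _; exact/shrink_le_self/sublinear_norm.
exists p.
  split=> // y; rewrite ler_norml pleN andbT.
  by have := pleN (- y); rewrite pN normN; lra.
apply/eqP; rewrite eq_le pleN /=.
have := shrink_le x (- x) sublinear_norm ler01; have := ple (- x).
by rewrite scale1r addNr norm0 mul1r pN; lra.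
Qed.

End HahnBanach.

(** * Bounded linear functionals and biorthogonal systems *)

Section LinearFunctionals.
Context (R : realType) (V : lmodType R).
Implicit Types (f g : V -> R) (x y z : V).

Definition lin f := forall a x y, f (a *: x + y) = a * f x + f y.

Lemma lin0 f : lin f -> f 0 = 0.
Proof. by move=> lf; have := lf 1 0 0; rewrite scaler0 addr0; lra. Qed.

Lemma linZ f a x : lin f -> f (a *: x) = a * f x.
Proof. by move=> lf; have := lf a x 0; rewrite !addr0 (lin0 lf) addr0. Qed.

Lemma linD f x y : lin f -> f (x + y) = f x + f y.
Proof. by move=> lf; have := lf 1 x y; rewrite scale1r mul1r. Qed.

Lemma linN f x : lin f -> f (- x) = - f x.
Proof. by move=> lf; rewrite -scaleN1r linZ// mulN1r. Qed.

Lemma linB f x y : lin f -> f (x - y) = f x - f y.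
Proof. by move=> lf; rewrite linD// linN. Qed.

Lemma lin_sum f (I : Type) (r : seq I) (P : pred I) (F : I -> V) : lin f ->
  f (\sum_(i <- r | P i) F i) = \sum_(i <- r | P i) f (F i).
Proof.
by move=> lf; apply: (big_morph f); [move=> x y; exact: linD|exact: lin0].
Qed.

Context (N : V -> R) (hN : is_norm N).

Definition blin f := exists M, dual_ball (fun x => M * N x) f.

Lemma dual_ball_blin f : dual_ball N f -> blin f.
Proof. by exists 1; case: H => lf h; split=> // x; rewrite mul1r. Qed.

Lemma blinD f g : blin f -> blin g -> blin (fun x => f x + g x).
Proof.
move=> [M [lf hf]] [L [lg hg]]; exists (M + L); split=> [a x y|x].
  by rewrite lf lg; ring.
by rewrite mulrDl (le_trans (ler_normD _ _))// lerD.
Qed.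

Lemma blinZ c f : blin f -> blin (fun x => c * f x).
Proof.
move=> [M [lf hf]]; exists (`|c| * M); split=> [a x y|x]; first by rewrite lf; ring.
by rewrite normrM -mulrA ler_wpM2l.
Qed.

Lemma blin_cst0 : blin (fun=> 0).
Proof. by exists 0; split=> [a x y|x]; rewrite ?mulr0 ?addr0// normr0 mul0r. Qed.

Lemma blin_sum n (F : 'I_n -> V -> R) : (forall i, blin (F i)) ->
  blin (fun x => \sum_(i < n) F i x).
Proof.
elim: n F => [|n IH] F bF.
  by have -> : (fun x => \sum_(i < 0) F i x) = fun=> 0;
    [apply/funext => x; rewrite big_ord0|exact: blin_cst0].
have -> : (fun x => \sum_(i < n.+1) F i x) =
  fun x => \sum_(i < n) F (widen_ord (leqnSn n) i) x + F ord_max x.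
  by apply/funext => x; rewrite big_ord_recr.
by apply: blinD => //; exact: IH.
Qed.

(** The dual norm need not be attained; the factor [2] leaves room for a [z] in the unit ball with
    [f z] above half of the supremum, after a change of sign if necessary. *)
Lemma near_norming f : blin f ->
  exists z, N z <= 1 /\ forall y, `|f y| <= 2 * f z * N y.
Proof.
move=> [M [lf hf]]; pose A := [set `|f y| | y in [set y | N y <= 1]].
have N00 : N 0 = 0 by exact: norm0.
have supA : has_sup A.
  split; first by exists `|f 0|, 0 => //=; rewrite N00.
  exists `|M| => _ [y /= y1 <-]; apply: le_trans (hf y) _.
  have Ny := norm_ge0 hN y; have [M0|M0] := leP 0 M.
    by rewrite -[leRHS]mulr1 ler_pM// ?ler_norm.
  by rewrite (@le_trans _ _ 0)// mulr_le0_ge0// ltW.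
have leS y : `|f y| <= sup A * N y.
  have [Ny0|Ny0] := eqVneq (N y) 0.
    by rewrite (norm_eq0 hN Ny0) (lin0 lf) normr0 N00 mulr0.
  have Ny : 0 < N y by rewrite lt_def Ny0 norm_ge0.
  rewrite -ler_pdivrMr//; apply: ub_le_sup; first by case: supA.
  exists ((N y)^-1 *: y); last by rewrite linZ// normrM ger0_norm ?invr_ge0 ?norm_ge0// mulrC.
  by rewrite /= normZ_eq// ger0_norm ?invr_ge0 ?norm_ge0// mulVf.
have [S0|S0] := leP (sup A) 0.
  exists 0; split; first by rewrite N00.
  move=> y; rewrite (lin0 lf) mulr0 mul0r; apply: le_trans (leS y) _.
  by rewrite mulr_le0_ge0// norm_ge0.
have [|_ [y /= y1 <-] hy] := @sup_adherent _ A (sup A / 2) _ supA.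
  by rewrite divr_gt0.
have key z : sup A - sup A / 2 < f z -> forall y, `|f y| <= 2 * f z * N y.
  by move=> hz w; apply: le_trans (leS w) _; rewrite ler_wpM2r ?norm_ge0//; lra.
have [fy|fy] := leP 0 (f y).
  by exists y; split=> //; apply: key; rewrite ger0_norm in hy.
exists (- y); split; first by rewrite normN.
by apply: key; rewrite ltr0_norm in hy => //; rewrite linN.
Qed.

Lemma blin_normalize f x : blin f -> f x <> 0 ->
  exists2 c, 0 < c & dual_ball N (fun y => c * f y) /\
    exists z, N z <= 1 /\ 1 / 2 <= c * f z.
Proof.
move=> bf fx0; have [z [z1 hz]] := near_norming bf.
have fz : 0 < f z.
  rewrite ltNge; apply/negP => fz; apply: fx0; apply/eqP; rewrite -normr_le0.
  apply: le_trans (hz x) _; rewrite mulr_le0_ge0// ?norm_ge0//; lra.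
have [M [lf _]] := bf.
exists (2 * f z)^-1; first by rewrite invr_gt0 mulr_gt0.
split; last by exists z; split=> //; rewrite invfM -mulrA mulVf ?gt_eqF// div1r mulr1.
split=> [a y w|y]; first by rewrite lf; ring.
by rewrite normrM ger0_norm ?invr_ge0 ?mulr_ge0 ?(ltW fz)// mulrC ler_pdivrMr
  ?mulr_gt0// mulrC.
Qed.

Hypothesis fdV : ~ finite_dimensional V.

(** A vector outside the span of the earlier [x j], minus its components, gives [y]. A norming
    functional of [y], scaled and then corrected by the earlier [e j] so as to vanish at the [x j],
    is the new functional; the correction does not affect its value at [y], where the [e j]
    vanish. *)
Lemma biorthogonal n : exists (e : nat -> V -> R) (x : nat -> V),
  (forall i, (i < n)%N -> blin (e i)) /\
  (forall i j, (i < n)%N -> (j < n)%N -> e i (x j) = (i == j)%:R).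
Proof.
elim: n => [|n [e [x [be ex]]]]; first by exists (fun _ _ => 0), (fun=> 0).
have le i : (i < n)%N -> lin (e i) by move=> /be[M []].
have [w hw] : exists w, forall c : 'I_n -> R, w <> \sum_(i < n) c i *: x i.
  apply: contrapT => h; apply: fdV; exists n, (fun i => x i) => w.
  by apply: contrapT => hw; apply: h; exists w => c wc; apply: hw; exists c.
pose y := w - \sum_(j < n) e j w *: x j.
have y0 : N y <> 0.
  move=> /(norm_eq0 hN)/eqP; rewrite subr_eq0 => /eqP; exact: hw.
have ey i : (i < n)%N -> e i y = 0.
  move=> ltin; rewrite linB; last exact: le.
  rewrite lin_sum; last exact: le.
  rewrite (bigD1 (Ordinal ltin))//= big1 => [|j /negP ji].
    by rewrite linZ; [rewrite ex// eqxx mulr1 addr0 subrr|exact: le].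
  rewrite linZ; last exact: le.
  rewrite ex//; case: eqP => [ij|]; last by rewrite mulr0.
  by exfalso; apply: ji; apply/eqP/val_inj.
have [f df fy] := norming_functional hN y.
pose g := fun z => (N y)^-1 * f z.
have bg : blin g by exact/blinZ/dual_ball_blin.
have gy : g y = 1 by rewrite /g fy mulVf//; exact/eqP.
pose en := fun z => g z + \sum_(j < n) - g (x j) * e j z.
exists (fun i => if i == n then en else e i), (fun i => if i == n then y else x i).
split=> [i|i j].
  rewrite ltnS leq_eqVlt; have [-> _|_ /= ltin] := eqVneq i n; last exact: be.
  apply: blinD => //; apply: blin_sum => j; apply: blinZ; exact: be.
rewrite !ltnS leq_eqVlt (leq_eqVlt j).
have [-> _|ni /= ltin] := eqVneq i n; have [-> _|nj /= ltjn] := eqVneq j n.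
- by rewrite /en gy big1 ?addr0// => k _; rewrite ey// mulr0.
- rewrite /en (bigD1 (Ordinal ltjn))//= big1 => [|k /negP kj].
    by rewrite ex// eqxx mulr1 addr0 subrr.
  rewrite ex//; case: eqP => [kjE|]; last by rewrite mulr0.
  by exfalso; apply: kj; apply/eqP/val_inj.
- by rewrite ey ?(negPf ni).
- by rewrite ex.
Qed.

(** Among [size D + 1] biorthogonal functionals some non-trivial combination vanishes on the
    [size D] vectors of [D]; its value at [x i] is [v 0 i], so it is non-zero and can be
    normalized. *)
Lemma functional_vanishing_on (D : seq V) : exists f,
  [/\ dual_ball N f, (forall x, x \in D -> f x = 0) &
      exists z, N z <= 1 /\ 1 / 2 <= f z].
Proof.
pose n := size D; have [e [x [be ex]]] := biorthogonal n.+1.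
pose A : 'M[R]_(n.+1, n) := \matrix_(i, j) e i (nth 0 D j).
have kA : kermx A != 0.
  rewrite -mxrank_eq0 mxrank_ker subn_eq0 -ltnNge ltnS; exact: rank_leq_col.
have /rowV0Pn[v /sub_kermxP vA v0] := kA.
pose f := fun z => \sum_(i < n.+1) v 0 i * e i z.
have bf : blin f by apply: blin_sum => i; apply: blinZ; exact: be.
have [i vi] : exists i, v 0 i != 0.
  apply: contrapT => h; move/eqP : v0; apply; apply/rowP => i; rewrite mxE.
  by apply/eqP; apply: contrapT => /negP vi; apply: h; exists i.
have fxi : f (x i) = v 0 i.
  rewrite /f (bigD1 i)//= ex// eqxx mulr1 big1 ?addr0// => j /negPf ji.
  by rewrite ex//= (_ : (j == i :> nat) = false) ?mulr0.
have [|c c0 [dc hz]] := blin_normalize (x := x i) bf; first by rewrite fxi; exact/eqP.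
exists (fun y => c * f y); split=> // y yD.
have yn : (index y D < n)%N by rewrite index_mem.
have := congr1 (fun B : 'rV_n => B 0 (Ordinal yn)) vA.
rewrite !mxE => h.
rewrite (_ : f y = 0) ?mulr0// -[RHS]h; apply: eq_bigr => j _.
by rewrite mxE /= nth_index.
Qed.

End LinearFunctionals.

(** * Averages of tails and the Josefson-Nissenzweig theorem *)

Section Refinement.
Context (R : realType) (V : lmodType R) (N : V -> R) (hN : is_norm N).
Implicit Types (f g h : nat -> V -> R) (x y z : V) (u v : V -> R).

(* Midpoints suffice, as only dyadic averages are ever formed. *)
Inductive midhull (S : set (V -> R)) : (V -> R) -> Prop :=
| midhull_in u : S u -> midhull S u
| midhull_mid u v : midhull S u -> midhull S v ->
    midhull S (fun x => (u x + v x) / 2).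

Definition tail g n : set (V -> R) := [set u | exists2 k, (n <= k)%N & u = g k].

Definition refines h g :=
  forall n, exists m, forall k, (m <= k)%N -> midhull (tail g n) (h k).

Definition diverges (k : nat -> nat) :=
  forall n, exists m, forall i, (m <= i)%N -> (n <= k i)%N.

Definition frequently (P : nat -> Prop) := forall n, exists2 k, (n <= k)%N & P k.

Lemma midhull_sub (S T : set (V -> R)) u :
  S `<=` midhull T -> midhull S u -> midhull T u.
Proof.
by move=> ST; elim=> [w /ST//|w v _ IHw _ IHv]; exact: midhull_mid.
Qed.

Lemma midhull_le (S : set (V -> R)) x c u :
  (forall w, S w -> w x <= c) -> midhull S u -> u x <= c.
Proof. move=> Sc; elim=> [w /Sc//|w v _ hw _ hv]; lra. Qed.

Lemma midhull_ge (S : set (V -> R)) x c u :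
  (forall w, S w -> c <= w x) -> midhull S u -> c <= u x.
Proof. move=> Sc; elim=> [w /Sc//|w v _ hw _ hv]; lra. Qed.

Lemma dual_ball_mid u v : dual_ball N u -> dual_ball N v ->
  dual_ball N (fun x => (u x + v x) / 2).
Proof.
move=> [lu hu] [lv hv]; split=> [a x y|x]; first by rewrite lu lv; field.
by have := hu x; have := hv x; rewrite !ler_norml => /andP[? ?] /andP[? ?]; lra.
Qed.

Lemma midhull_dual_ball S u : S `<=` dual_ball N -> midhull S u -> dual_ball N u.
Proof. by move=> Sb; elim=> [w /Sb//|w v _ hw _ hv]; exact: dual_ball_mid. Qed.

Lemma tail_sub g m n : (m <= n)%N -> tail g n `<=` tail g m.
Proof. by move=> mn u [k nk ->]; exists k => //; exact: leq_trans nk. Qed.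

Lemma midhull_tail g m n u : (m <= n)%N -> midhull (tail g n) u -> midhull (tail g m) u.
Proof. by move=> mn; apply: midhull_sub => w /(tail_sub mn) gw; exact: midhull_in. Qed.

Lemma refines_refl g : refines g g.
Proof. by move=> n; exists n => k nk; apply: midhull_in; exists k. Qed.

Lemma refines_trans h g f : refines h g -> refines g f -> refines h f.
Proof.
move=> hg gf n; have [m hm] := gf n; have [l hl] := hg m; exists l => k lk.
apply: midhull_sub (hl k lk) => _ [i mi ->]; exact: hm.
Qed.

Lemma refines_comp g k : diverges k -> refines (g \o k) g.
Proof.
by move=> dk n; have [m hm] := dk n; exists m => i mi; apply: midhull_in;
  exists (k i) => //; exact: hm.
Qed.

(** The [k]-th term of the diagonal is taken from [G k] so far out that it is an average of terms
    beyond [k] of every [G j] with [j <= k]. *)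
Lemma refines_diagonal (G : nat -> nat -> V -> R) :
  (forall n, refines (G n.+1) (G n)) -> exists d, forall n, refines d (G n).
Proof.
move=> GS; have Gn n j : (j <= n)%N -> refines (G n) (G j).
  elim: n => [|n IH]; first by rewrite leqn0 => /eqP ->; exact: refines_refl.
  rewrite leq_eqVlt => /orP[/eqP->|jn]; first exact: refines_refl.
  by apply: refines_trans (GS n) _; exact: IH.
have ex k : exists m, forall j, (j <= k)%N -> midhull (tail (G j) k) (G k m).
  have exj j : exists m, (j <= k)%N ->
      forall i, (m <= i)%N -> midhull (tail (G j) k) (G k i).
    have [jk|kj] := leqP j k; last by exists 0%N.
    by have [m hm] := Gn k j jk k; exists m.
  have [M hM] := choice exj.
  exists (\max_(j < k.+1) M j) => j jk; apply: hM => //.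
  rewrite -ltnS in jk; exact: (@leq_bigmax_cond _ _ (fun j : 'I_k.+1 => M j) (Ordinal jk)).
have [m hm] := choice ex; exists (fun k => G k (m k)) => n i; exists (maxn n i) => k.
by rewrite geq_max => /andP[nk ik]; exact: midhull_tail ik (hm _ _ nk).
Qed.

Definition oscillates g t := exists x a b,
  [/\ N x <= 1, t <= a - b, frequently (fun k => a <= g k x)
    & frequently (fun k => g k x <= b)].

Lemma midhull_exists_ge (S : set (V -> R)) x c u : midhull S u -> c <= u x ->
  exists2 w, S w & c <= w x.
Proof.
elim=> [w Sw cw|w v _ hw _ hv cwv]; first by exists w.
by have [cw|cw] := leP c (w x); [exact: hw|apply: hv; lra].
Qed.

Lemma midhull_exists_le (S : set (V -> R)) x c u : midhull S u -> u x <= c ->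
  exists2 w, S w & w x <= c.
Proof.
elim=> [w Sw cw|w v _ hw _ hv cwv]; first by exists w.
by have [cw|cw] := leP (w x) c; [exact: hw|apply: hv; lra].
Qed.

Lemma refines_frequently_ge h g x a : refines h g ->
  frequently (fun k => a <= h k x) -> frequently (fun k => a <= g k x).
Proof.
move=> hg fh n; have [m hm] := hg n; have [k mk ak] := fh m.
by have [_ [i ni ->] ai] := midhull_exists_ge (hm _ mk) ak; exists i.
Qed.

Lemma refines_frequently_le h g x a : refines h g ->
  frequently (fun k => h k x <= a) -> frequently (fun k => g k x <= a).
Proof.
move=> hg fh n; have [m hm] := hg n; have [k mk ak] := fh m.
by have [_ [i ni ->] ai] := midhull_exists_le (hm _ mk) ak; exists i.
Qed.

Lemma refines_oscillates h g t : refines h g -> oscillates h t -> oscillates g t.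
Proof.
move=> hg [x [a [b [x1 ab ha hb]]]]; exists x, a, b; split=> //.
  exact: refines_frequently_ge hg ha.
exact: refines_frequently_le hg hb.
Qed.

Definition bounded_seq g := forall k, dual_ball N (g k).

(* The supremum over the unit ball of [limsup g k x - liminf g k x]. *)
Definition omega g := sup (oscillates g).

Lemma has_sup_oscillates g : bounded_seq g -> has_sup (oscillates g).
Proof.
move=> bg; split.
  exists 0, 0, 0, 0; rewrite (norm0 hN) subrr; split=> // n; exists n => //.
    by rewrite (lin0 (bg n).1).
  by rewrite (lin0 (bg n).1).
exists 2 => t [x [a [b [x1 ab ha hb]]]].
have [k _ ak] := ha 0%N; have [l _ bl] := hb 0%N.
have := (bg k).2 x; have := (bg l).2 x; rewrite !ler_norml => /andP[? ?] /andP[? ?]; lra.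
Qed.

Lemma oscillates_le_omega g t : bounded_seq g -> oscillates g t -> t <= omega g.
Proof. by move=> bg gt; apply: ub_le_sup => //; case: (has_sup_oscillates bg). Qed.

Lemma refines_tail_bounded h g : bounded_seq g -> refines h g ->
  exists m, forall k, (m <= k)%N -> dual_ball N (h k).
Proof.
move=> bg /(_ 0%N)[m hm]; exists m => k mk.
by apply: midhull_dual_ball (hm _ mk) => _ [i _ ->].
Qed.

(* [refines] says nothing on finitely many terms, so boundedness is a separate
   requirement on the refining sequence. *)
Definition subrefines h g := refines h g /\ bounded_seq h.

Lemma refines_shift h g : bounded_seq g -> refines h g ->
  exists m, subrefines (fun k => h (m + k)%N) g.
Proof.
move=> bg hg; have [m hm] := refines_tail_bounded bg hg; exists m; split.
  apply: refines_trans hg; apply: (@refines_comp h (fun k => m + k)%N) => n.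
  by exists n => i ni; exact: leq_trans (leq_addl _ _).
by move=> k; apply: hm; exact: leq_addr.
Qed.

Lemma subrefines_omega h g : bounded_seq g -> subrefines h g -> omega h <= omega g.
Proof.
move=> bg [hg bh]; apply: ge_sup; first by case: (has_sup_oscillates bh).
by move=> t /(refines_oscillates hg); exact: oscillates_le_omega.
Qed.

(** [G n.+1] refines [G n] with [omega] within [1 / (n + 1)] of the infimum over all such
    refinements. A refinement of the diagonal refines every [G n], so its [omega] cannot drop below
    that of the diagonal. *)
Lemma stabilize_omega f : bounded_seq f -> exists2 g, subrefines g f &
  forall h, subrefines h g -> omega g <= omega h.
Proof.
move=> bf; pose s g := inf [set omega h | h in [set h | subrefines h g]].
have omega_ge0 g : bounded_seq g -> 0 <= omega g.
  move=> bg; apply: oscillates_le_omega => //.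
  exists 0, 0, 0; rewrite (norm0 hN) subrr; split=> // n; exists n => //.
    by rewrite (lin0 (bg n).1).
  by rewrite (lin0 (bg n).1).
have s_le h g : subrefines h g -> s g <= omega h.
  move=> hg; apply: ge_inf; last by exists h.
  by exists 0 => _ [w [_ bw] <-]; exact: omega_ge0.
have near_s g (n : nat) : exists h, bounded_seq g ->
    subrefines h g /\ omega h < s g + n.+1%:R^-1.
  have [bg|nbg] := pselect (bounded_seq g); last by exists g.
  have [||_ [h hg <-] lt] := @inf_adherent _ [set omega h | h in [set h | subrefines h g]]
      n.+1%:R^-1 _ _; first by rewrite invr_gt0.
    split; first by exists (omega g), g => //; split=> //; exact: refines_refl.
    by exists 0 => _ [w [_ bw] <-]; exact: omega_ge0.
  by exists h.
pose nx g n := sval (cid (near_s g n)).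
have nxP g n := svalP (cid (near_s g n)).
pose G := fix G n := if n is m.+1 then nx (G m) m else f.
have bG n : bounded_seq (G n).
  by elim: n => [//|n IH] /=; have [[]] := nxP (G n) n IH.
have GS n : subrefines (G n.+1) (G n) by have [] := nxP (G n) n (bG n).
have [d0 hd0] := refines_diagonal (fun n => (GS n).1).
have [m [rd bd]] := refines_shift (bG 0%N) (hd0 0%N).
have hd n : refines (fun k => d0 (m + k)%N) (G n).
  apply: refines_trans (hd0 n); apply: (@refines_comp d0 (fun k => m + k)%N) => j.
  by exists j => i ji; exact: leq_trans (leq_addl _ _).
exists (fun k => d0 (m + k)%N); first by split.
move=> h [hh bh]; rewrite leNgt; apply/negP => lt.
have [n hn] : exists n : nat, n.+1%:R^-1 < omega (fun k => d0 (m + k)%N) - omega h.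
  have := lt; rewrite -subr_gt0 => /ltr_add_invr[n]; rewrite add0r => hn.
  by exists n.
have lt_s : omega (G n.+1) < s (G n) + n.+1%:R^-1 := (nxP (G n) n (bG n)).2.
have := s_le h (G n) (conj (refines_trans hh (hd n)) bh).
have := subrefines_omega (bG n.+1) (conj (hd n.+1) bd).
move=> h1 h2; have := le_lt_trans h1 lt_s; move: h2 hn; set i := _^-1; lra.
Qed.

Definition norm_cauchy h := forall e, 0 < e -> exists n, forall k l,
  (n <= k)%N -> (n <= l)%N -> forall x, `|h k x - h l x| <= e * N x.

Definition pointwise_null h := forall x e, 0 < e ->
  exists n, forall k, (n <= k)%N -> `|h k x| < e.

Definition JN_sequence := exists2 c, 0 < c & exists h,
  [/\ bounded_seq h, (forall k, exists2 x, N x <= 1 & c <= h k x)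
    & pointwise_null h].

(** The candidate is the upper limit; as there is no oscillation, it is also the lower limit, and
    linearity passes to the limit. *)
Lemma pointwise_limit g : bounded_seq g -> omega g <= 0 ->
  exists2 l, dual_ball N l & pointwise_null (fun k x => g k x - l x).
Proof.
move=> bg og; pose l x := sup [set a | frequently (fun k => a <= g k x)].
have bx k x : - N x <= g k x <= N x by rewrite -ler_norml; exact: (bg k).2.
have sx x : has_sup [set a | frequently (fun k => a <= g k x)].
  split; first by exists (- N x) => n; exists n => //; case/andP: (bx n x).
  exists (N x) => a /(_ 0%N)[k _ ak]; have /andP[_] := bx k x; lra.
have gl : pointwise_null (fun k x => g k x - l x).
  move=> x e e0.
  have [n hn] : exists n, forall k, (n <= k)%N -> g k x < l x + e.
    apply: contrapT => h; have : l x + e <= l x; last lra.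
    apply: ub_le_sup; first by case: (sx x).
    move=> n; apply: contrapT => hn; apply: h; exists n => k nk.
    by rewrite ltNge; apply/negP => le; apply: hn; exists k.
  have [m hm] : exists n, forall k, (n <= k)%N -> l x - e < g k x.
    apply: contrapT => h.
    have fle : frequently (fun k => g k x <= l x - e).
      move=> j; apply: contrapT => hj; apply: h; exists j => k nk.
      by rewrite ltNge; apply/negP => le; apply: hj; exists k.
    have [|a fa la] := @sup_adherent _ _ (e / 2) _ (sx x); first lra.
    (* Dividing by [N x + 1] brings [x] into the unit ball, also when [N x = 0]. *)
    have Nx := norm_ge0 hN x; have N1 : 0 < N x + 1 by lra.
    have : (e / 2) / (N x + 1) <= omega g.
      apply: oscillates_le_omega => //.
      exists ((N x + 1)^-1 *: x), (a / (N x + 1)), ((l x - e) / (N x + 1)); split.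
      - by rewrite normZ_eq// ger0_norm ?invr_ge0 ?(ltW N1)// mulrC ler_pdivrMr//; lra.
      - by rewrite -mulrBl ler_wpM2r ?invr_ge0 ?(ltW N1)//; rewrite -/(l x) in la; lra.
      - move=> j; have [k jk ak] := fa j; exists k => //.
        by rewrite (linZ _ _ (bg k).1) mulrC ler_wpM2l ?invr_ge0 ?(ltW N1).
      - move=> j; have [k jk ak] := fle j; exists k => //.
        by rewrite (linZ _ _ (bg k).1) mulrC ler_wpM2r ?invr_ge0 ?(ltW N1).
    have : 0 < (e / 2) / (N x + 1) by rewrite !divr_gt0.
    lra.
  exists (maxn n m) => k; rewrite geq_max => /andP[/hn ? /hm ?].
  by rewrite ltr_norml; apply/andP; split; lra.
exists l => //; split=> [a x y|x].
  apply/eqP; rewrite -subr_eq0 -normr_le0 leNgt; apply/negP => d0.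
  set D := `|_| in d0; have C0 : 0 < `|a| + 2 by have := normr_ge0 a; lra.
  have e0 : 0 < D / (`|a| + 2) / 2 by rewrite !divr_gt0.
  have [n1 h1] := gl (a *: x + y) _ e0; have [n2 h2] := gl x _ e0.
  have [n3 h3] := gl y _ e0; pose k := maxn n1 (maxn n2 n3).
  have := h1 k (leq_maxl _ _).
  have := h2 k; rewrite leq_max leq_max leqnn orbT => /(_ isT).
  have := h3 k; rewrite leq_max (leq_max n3) leqnn !orbT => /(_ isT).
  rewrite (bg k).1; set e := _ / _ => H3 H2 H1.
  have eD : e * (`|a| + 2) = D / 2.
    by rewrite /e mulrAC divfK// gt_eqF.
  have H4 : `|a * (g k x - l x)| <= `|a| * e by rewrite normrM ler_wpM2l// ltW.
  have : D <= e + `|a| * e + e; last by lra.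
  rewrite /D (_ : _ - _ = - (a * g k x + g k y - l (a *: x + y)) +
    a * (g k x - l x) + (g k y - l y)); last by ring.
  apply: le_trans (ler_normD _ _) _; apply: lerD; last exact: ltW.
  by apply: le_trans (ler_normD _ _) _; rewrite normrN; apply: lerD; [exact: ltW|].
rewrite leNgt; apply/negP; rewrite -subr_gt0 => lt.
have [n hn] := gl x _ lt; have := hn _ (leqnn n); have := (bg n).2 x.
have := ler_normD (l x - g n x) (g n x); rewrite subrK distrC; lra.
Qed.

(** If [g] is not Cauchy in norm, some subsequence stays at a fixed distance from the pointwise
    limit [l]; the halves of the differences lie in the dual ball and tend to [0] pointwise. *)
Lemma norm_cauchy_or_JN g : bounded_seq g -> omega g <= 0 ->
  norm_cauchy g \/ JN_sequence.
Proof.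
move=> bg og; have [l bl gl] := pointwise_limit bg og.
have [|ncg] := pselect (norm_cauchy g); [by left|right].
have [e e0 he] : exists2 e, 0 < e &
    forall n, exists2 k, (n <= k)%N & exists x, e * N x < g k x - l x.
  apply: contrapT => h; apply: ncg => e e0; apply: contrapT => he; apply: h.
  exists (e / 2); first by rewrite divr_gt0.
  move=> n; apply: contrapT => hn; apply: he; exists n => k k' nk nk' x.
  have hk i y : (n <= i)%N -> g i y - l y <= e / 2 * N y.
    by move=> ni; rewrite leNgt; apply/negP => lt; apply: hn; exists i => //; exists y.
  have hkN i y : (n <= i)%N -> l y - g i y <= e / 2 * N y.
    move=> ni; have := hk i (- y) ni.
    by rewrite (linN _ (bg i).1) (linN _ bl.1) (normN hN); lra.
  have := hk k x nk; have := hk k' x nk'; have := hkN k x nk; have := hkN k' x nk'.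
  by move=> ? ? ? ?; rewrite ler_norml; apply/andP; split; lra.
have {}he n : exists k, (n <= k)%N /\ exists x, e * N x < g k x - l x.
  by have [k nk hk] := he n; exists k.
have [k hk] := choice he.
exists (e / 2); first by rewrite divr_gt0.
exists (fun n x => (g (k n) x - l x) / 2); split.
- move=> n; split=> [a x y|x].
    by rewrite (bg _).1 bl.1; field.
  have := (bg (k n)).2 x; have := bl.2 x; rewrite !ler_norml => /andP[? ?] /andP[? ?].
  by apply/andP; split; lra.
- move=> n; have [nk [x hx]] := hk n; have Nx : 0 < N x.
    rewrite lt_def (norm_ge0 hN) andbT; apply/eqP => Nx; move: hx.
    rewrite (norm_eq0 hN Nx) (lin0 (bg _).1) (lin0 bl.1) (norm0 hN) mulr0 subrr.
    by rewrite ltxx.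
  exists ((N x)^-1 *: x).
    by rewrite normZ_eq// ger0_norm ?invr_ge0 ?(ltW Nx)// mulVf// gt_eqF.
  rewrite (linZ _ _ (bg _).1) (linZ _ _ bl.1) -mulrBr ler_pM2r ?invr_gt0//.
  by rewrite mulrC ler_pdivlMr// ltW.
- move=> x d d0; have [n hn] := gl x d d0; exists n => i ni.
  have := hn (k i) (leq_trans ni (hk i).1); rewrite normrM.
  rewrite (@ger0_norm _ 2^-1)//; have := normr_ge0 (g (k i) x - l x); lra.
Qed.

End Refinement.

Section UltraLimit.
Context (R : realType) (U : set_system nat) (hU : UltraFilter U).

Definition ultralim (u : nat -> R) : R := sup [set a | U [set n | a <= u n]].

Lemma ultralimP (M : R) (u : nat -> R) :
  (forall n, `|u n| <= M) -> u @ U --> ultralim u.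
Proof.
move=> uM; have PU : ProperFilter U := ultra_proper.
have supA : has_sup [set a | U [set n | a <= u n]].
  split.
    exists (- M) => /=; apply: filterS filterT => n _.
    by have := uM n; rewrite ler_norml => /andP[].
  exists M => a Ua; have [n /= an] := filter_ex Ua.
  by apply: le_trans an _; apply: le_trans (ler_norm _) (uM n).
apply/cvgrPdist_lt => e e0.
have [a /= Ua la] := sup_adherent e0 supA.
have nU : ~ U [set n | ultralim u + e <= u n].
  by move=> h; have := sup_upper_bound supA h; rewrite -/(ultralim u); lra.
have [//|{}nU] := in_ultra_setVsetC [set n | ultralim u + e <= u n] hU.
near=> n; rewrite -/(ultralim u) in la.
have an : a <= u n by near: n.
have : ~ (ultralim u + e <= u n) by near: n.
by move/negP; rewrite -ltNge => h; rewrite ltr_norml; apply/andP; split; lra.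
Unshelve. all: by end_near. Qed.

End UltraLimit.

(** * Rademacher averages along a dyadic tree of subsequences *)

Section RademacherTree.
Context (R : realType) (V : lmodType R) (N : V -> R) (hN : is_norm N).
Context (g : nat -> V -> R) (bg : bounded_seq N g).

Notation branching := ((nat -> nat) * (nat -> nat))%type.
Implicit Types (ks : seq branching) (k : nat -> nat) (x y : V).

(** A list of pairs of index maps encodes a full binary tree: at each level a node [k] has the
    children [k \o K.1] and [k \o K.2]. *)
Fixpoint leaf ks k : set (nat -> nat) :=
  if ks is K :: ks' then leaf ks' (k \o K.1) `|` leaf ks' (k \o K.2) else [set k].

Fixpoint average ks k (i : nat) x : R :=
  if ks is K :: ks' then
    (average ks' (k \o K.1) i x + average ks' (k \o K.2) i x) / 2
  else g (k i) x.

(** The mean over the leaves [k'] of [g (k' 0) x], with the sign plus or minus according to the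
    branch taken at level [n]; it is [0] when [n] exceeds the depth. *)
Fixpoint rademacher ks k (n : nat) x : R :=
  if ks is K :: ks' then
    if n is m.+1 then
      (rademacher ks' (k \o K.1) m x + rademacher ks' (k \o K.2) m x) / 2
    else (average ks' (k \o K.1) 0 x - average ks' (k \o K.2) 0 x) / 2
  else 0.

Definition diverging ks := forall K, List.In K ks -> diverges K.1 /\ diverges K.2.

Lemma diverges_comp (k l : nat -> nat) : diverges k -> diverges l -> diverges (k \o l).
Proof.
move=> dk dl n; have [m hm] := dk n; have [j hj] := dl m.
by exists j => i ji; apply/hm/hj.
Qed.

Lemma average_dual ks k i : dual_ball N (average ks k i).
Proof.
elim: ks k => [|K ks IH] k; first exact: bg.
exact: (dual_ball_mid (IH _) (IH _)).
Qed.

Lemma average_refines ks k : diverging ks -> diverges k ->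
  refines (average ks k) g.
Proof.
elim: ks k => [|K ks IH] k dks dk; first exact: refines_comp dk.
have [dK1 dK2] := dks K (or_introl erefl).
have dks' : diverging ks by move=> L Lks; apply: dks; right.
move=> n; have [m1 h1] := IH _ dks' (diverges_comp dk dK1) n.
have [m2 h2] := IH _ dks' (diverges_comp dk dK2) n.
exists (maxn m1 m2) => i; rewrite geq_max => /andP[/h1 ? /h2 ?].
exact: midhull_mid.
Qed.

(** Among [2 ^ size ks] leaves that are all at most [B], the deficit of a single one is at most
    [2 ^ size ks] times the mean deficit. *)
Lemma leaf_lower ks k i x (A B : R) :
  (forall k', leaf ks k k' -> g (k' i) x <= B) -> A <= average ks k i x ->
  forall k', leaf ks k k' -> B - 2 ^+ size ks * (B - A) <= g (k' i) x.
Proof.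
have avB ks' k0 : (forall k', leaf ks' k0 k' -> g (k' i) x <= B) ->
    average ks' k0 i x <= B.
  elim: ks' k0 => [|K ks' IH] k0 /= h; first exact: h.
  have := IH _ (fun l hl => h l (or_introl hl)).
  have := IH _ (fun l hl => h l (or_intror hl)); lra.
elim: ks k A => [|K ks IH] k A /= h hA k'; first by move=> ->; rewrite expr0; lra.
have h1 := avB _ _ (fun l hl => h l (or_introl hl)).
have h2 := avB _ _ (fun l hl => h l (or_intror hl)).
(* Two halves bounded by [B] with mean at least [A] are each at least [2 * A - B]. *)
have e : B - 2 ^+ (size ks).+1 * (B - A) = B - 2 ^+ size ks * (B - (2 * A - B)).
  by rewrite exprS; ring.
rewrite e; case=> kk'.
- apply: (IH (k \o K.1)) => //; [by move=> l hl; apply: h; left|lra].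
- apply: (IH (k \o K.2)) => //; [by move=> l hl; apply: h; right|lra].
Qed.

End RademacherTree.

Section RademacherBranch.
Context (R : realType) (V : lmodType R) (N : V -> R) (hN : is_norm N).
Implicit Types (g : nat -> V -> R) (x : V).
Notation branching := ((nat -> nat) * (nat -> nat))%type.

Lemma average_opp g ks k i x : average (fun j y => - g j y) ks k i x = - average g ks k i x.
Proof. by elim: ks k => [//|K ks IH] k /=; rewrite !IH; field. Qed.

Lemma leaf_upper g (ks : seq branching) k i x (A B : R) :
  (forall k', leaf ks k k' -> B <= g (k' i) x) -> average g ks k i x <= A ->
  forall k', leaf ks k k' -> g (k' i) x <= B + 2 ^+ size ks * (A - B).
Proof.
move=> h hA k' kk'; have := @leaf_lower R V (fun j y => - g j y) ks k i x (- A) (- B).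
move=> /(_ _ _ k' kk'); rewrite average_opp !lerN2 => H.
have : - B - 2 ^+ size ks * (- B - - A) <= - g (k' i) x.
  by apply: H => // l hl; rewrite lerN2 h.
by rewrite (_ : - B - - A = A - B); [lra|ring].
Qed.

Lemma frequently_eventually (P : nat -> Prop) (Q : nat -> Prop) n :
  frequently P -> (forall k, (n <= k)%N -> Q k) ->
  exists2 K, diverges K & forall k, P (K k) /\ Q (K k).
Proof.
move=> fP hQ; have ex k : exists j, (k <= j)%N /\ (P j /\ Q j).
  have [j] := fP (maxn k n); rewrite geq_max => /andP[kj nj] Pj.
  by exists j; split=> //; split=> //; exact: hQ.
have [K hK] := choice ex; exists K => [m|k]; last exact: (hK k).2.
by exists m => i mi; exact: leq_trans mi (hK i).1.
Qed.

Lemma eventually_leaves (P : nat -> Prop) n (ks : seq branching) :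
  diverging ks -> (forall k, (n <= k)%N -> P k) ->
  exists m, forall i, (m <= i)%N -> forall k', leaf ks id k' -> P (k' i).
Proof.
move=> dks hP.
suff H ks' k : diverging ks' -> diverges k -> exists m, forall i, (m <= i)%N ->
    forall k', leaf ks' k k' -> (n <= k' i)%N.
  have [|m hm] := H ks id dks; first by move=> j; exists j.
  by exists m => i mi k' kk'; apply: hP; exact: hm kk'.
elim: ks' k => [|K ks' IH] k dks' dk.
  by have [m hm] := dk n; exists m => i mi k' ->; exact: hm.
have [dK1 dK2] := dks' K (or_introl erefl).
have dks'' : diverging ks' by move=> L Lks; apply: dks'; right.
have [m1 h1] := IH _ dks'' (diverges_comp dk dK1).
have [m2 h2] := IH _ dks'' (diverges_comp dk dK2).
exists (maxn m1 m2) => i; rewrite geq_max => /andP[m1i m2i] k' [].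
  exact: h1.
exact: h2.
Qed.

Lemma not_frequently (P : nat -> Prop) : ~ frequently P ->
  exists n, forall k, (n <= k)%N -> ~ P k.
Proof.
move=> nf; apply: contrapT => h; apply: nf => n; apply: contrapT => hn; apply: h.
by exists n => k nk Pk; apply: hn; exists k.
Qed.

Definition separates g (ks : seq branching) x (a b : R) (K : branching) :=
  forall k', leaf ks id k' ->
    forall i, a <= g (k' (K.1 i)) x /\ g (k' (K.2 i)) x <= b.

(* The average over all current leaves refines [g], so by stability it
   oscillates almost as much as [g]; no leaf can oscillate more, hence all of
   them oscillate at the same vector and between the same levels. *)
Lemma stable_branching g (ks : seq branching) : bounded_seq N g ->
  0 < omega N g -> (forall h, subrefines N h g -> omega N g <= omega N h) ->
  diverging ks ->
  exists x a b K, [/\ N x <= 1, omega N g / 2 <= a - b, diverges K.1,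
    diverges K.2 & separates g ks x a b K].
Proof.
move=> bg w0 stable dks; set w := omega N g in w0 stable *.
pose C : R := 2 ^+ size ks; have C1 : 1 <= C by rewrite exprn_ege1// ler1n.
(* The total loss [e + 4 * C * e] is then at most [w / 2]. *)
pose e := w / (10 * C); have e0 : 0 < e by rewrite divr_gt0// mulr_gt0//; lra.
have eC : e * C = w / 10 by rewrite /e; field; lra.
have ew : e <= w / 10 by rewrite -eC ler_peMr// ltW.
have sh : subrefines N (average g ks id) g.
  split; last by move=> i; exact: average_dual.
  by apply: average_refines => // n; exists n.
have [t [x [a [b [x1 tab fa fb]]]] lt] :=
  sup_adherent e0 (has_sup_oscillates hN sh.2).
have {}lt : w - e < t by apply: le_lt_trans lt; have := stable _ sh; rewrite /omega; lra.
have ga := refines_frequently_ge sh.1 fa; have gb := refines_frequently_le sh.1 fb.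
have osc s : oscillates N g s -> s <= w by exact: oscillates_le_omega.
(* Since [a - b > w - e], values of [g] above [a + 2 * e], or below [b - 2 * e], infinitely often
   would make [g] oscillate by more than [w]. *)
have [n1 hn1] : exists n, forall k, (n <= k)%N -> g k x <= a + 2 * e.
  have [|n hn] := @not_frequently (fun k => a + 2 * e <= g k x).
    move=> f; suff : a + 2 * e - b <= w by lra.
    by apply: osc; exists x, (a + 2 * e), b.
  by exists n => k /hn/negP; rewrite -ltNge => /ltW.
have [n2 hn2] : exists n, forall k, (n <= k)%N -> b - 2 * e <= g k x.
  have [|n hn] := @not_frequently (fun k => g k x <= b - 2 * e).
    move=> f; suff : a - (b - 2 * e) <= w by lra.
    by apply: osc; exists x, a, (b - 2 * e).
  by exists n => k /hn/negP; rewrite -ltNge => /ltW.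
have [m1 hm1] := eventually_leaves dks hn1.
have [m2 hm2] := eventually_leaves dks hn2.
have [K1 dK1 hK1] := frequently_eventually fa hm1.
have [K2 dK2 hK2] := frequently_eventually fb hm2.
exists x, (a - 2 * C * e), (b + 2 * C * e), (K1, K2); split=> //; first by nra.
move=> k' kk' i; split.
  have [h1 h2] := hK1 i; have := leaf_lower h2 h1 kk'; rewrite -/C.
  by rewrite (_ : a + 2 * e - a = 2 * e); [lra|ring].
have [h1 h2] := hK2 i; have := leaf_upper h2 h1 kk'; rewrite -/C.
by rewrite (_ : b - (b - 2 * e) = 2 * e); [lra|ring].
Qed.

Section Functionals.
Context (g : nat -> V -> R) (bg : bounded_seq N g).

Lemma rademacher_lin (ks : seq branching) k n : lin (rademacher g ks k n).
Proof.
elim: ks k n => [|K ks IH] k n a x y; first by rewrite /= mulr0 addr0.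
case: n => [|n] /=; last by rewrite !IH; field.
by rewrite !(average_dual bg _ _ _).1; field.
Qed.

(** At the root this is the parallelogram identity for the two half averages; the deeper levels
    follow from convexity of the square. *)
Lemma bessel (ks : seq branching) k x :
  average g ks k 0 x ^+ 2 + \sum_(n < size ks) rademacher g ks k n x ^+ 2 <= N x ^+ 2.
Proof.
elim: ks k => [|K ks IH] k /=.
  rewrite big_ord0 addr0 -real_normK ?num_real// ler_pXn2r ?nnegrE ?normr_ge0 ?(norm_ge0 hN)//.
  exact: (bg _).2.
rewrite big_ord_recl /=; have h1 := IH (k \o K.1); have h2 := IH (k \o K.2).
have : \sum_(i < size ks) ((rademacher g ks (k \o K.1) i x +
    rademacher g ks (k \o K.2) i x) / 2) ^+ 2 <=
  (\sum_(i < size ks) rademacher g ks (k \o K.1) i x ^+ 2 +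
   \sum_(i < size ks) rademacher g ks (k \o K.2) i x ^+ 2) / 2.
  rewrite -big_split mulr_suml /= ler_sum// => i _.
  set p := rademacher _ _ _ _ _; set q := rademacher _ _ _ _ _.
  by have := sqr_ge0 (p - q); rewrite !expr2; lra.
move: h1 h2; set p := average _ _ _ _ _; set q := average _ _ _ _ _.
rewrite !expr2; lra.
Qed.

Lemma average_ge (ks : seq branching) k i x (a : R) :
  (forall j, a <= g (k j) x) -> a <= average g ks k i x.
Proof.
elim: ks k => [|K ks IH] k h /=; first exact: h.
have := IH (k \o K.1) (fun j => h _); have := IH (k \o K.2) (fun j => h _); lra.
Qed.

Lemma average_le (ks : seq branching) k i x (a : R) :
  (forall j, g (k j) x <= a) -> average g ks k i x <= a.
Proof.
elim: ks k => [|K ks IH] k h /=; first exact: h.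
have := IH (k \o K.1) (fun j => h _); have := IH (k \o K.2) (fun j => h _); lra.
Qed.

(** The levels above [K] average the difference over all nodes of that level, and the levels below
    it preserve the one-sided bounds. *)
Lemma rademacher_ge (ks1 ks2 : seq branching) (K : branching) k x (a b : R) :
  (forall k', leaf ks1 k k' ->
    forall i, a <= g (k' (K.1 i)) x /\ g (k' (K.2 i)) x <= b) ->
  (a - b) / 2 <= rademacher g (ks1 ++ K :: ks2) k (size ks1) x.
Proof.
elim: ks1 k => [|L ks1 IH] k h /=.
  have h1 : a <= average g ks2 (k \o K.1) 0 x.
    by apply: average_ge => j; have [] := h k erefl j.
  have h2 : average g ks2 (k \o K.2) 0 x <= b.
    by apply: average_le => j; have [] := h k erefl j.
  lra.
have := IH (k \o L.1) (fun k' hk => h k' (or_introl hk)).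
have := IH (k \o L.2) (fun k' hk => h k' (or_intror hk)); lra.
Qed.

End Functionals.

(** [r m n] is the average against the [m]-th Rademacher function in the tree of depth [n], and
    [phi m] is its limit along [U]. The lower bound from [separates] holds for all [n > m], and
    Bessel's inequality survives in the limit, so the [phi m x] are square summable. *)
Lemma stable_JN g (U : set_system nat) : UltraFilter U -> free_filter U ->
  bounded_seq N g ->
  0 < omega N g -> (forall h, subrefines N h g -> omega N g <= omega N h) ->
  JN_sequence N.
Proof.
move=> hU fU bg w0 stable; have PU : ProperFilter U := ultra_proper.
have step (ks : seq branching) : exists D : V * R * R * branching, diverging ks ->
    [/\ N D.1.1.1 <= 1, omega N g / 2 <= D.1.1.2 - D.1.2, diverges D.2.1,
      diverges D.2.2 & separates g ks D.1.1.1 D.1.1.2 D.1.2 D.2].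
  have [dks|ndks] := pselect (diverging ks); last by exists (0, 0, 0, (id, id)).
  have [x [a [b [K h]]]] := stable_branching bg w0 stable dks.
  by exists (x, a, b, K).
have [D hD] := choice step.
(* The new branching goes to the bottom of the tree, so that it splits exactly the leaves of [ks m]
   which it separates. *)
pose ks := fix ks n := if n is m.+1 then rcons (ks m) (D (ks m)).2 else [::].
have dks n : diverging (ks n).
  elim: n => [//|n IH] K /=; rewrite -cats1 => h.
  have [/IH//|[<-|//]] := @List.in_app_or _ _ [:: _] _ h.
  by have [_ _ d1 d2 _] := hD _ IH.
have sks n : size (ks n) = n by elim: n => //= n IH; rewrite size_rcons IH.
have ksE m n : (m < n)%N -> exists r, ks n = ks m ++ (D (ks m)).2 :: r.
  elim: n => // n IH; rewrite ltnS leq_eqVlt => /orP[/eqP<-|/IH[r /= ->]].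
    by exists [::]; rewrite cats1.
  by rewrite -cats1 -catA; eexists; reflexivity.
pose r m n x := rademacher g (ks n) id m x.
have bes n x : \sum_(m < n) r m n x ^+ 2 <= N x ^+ 2.
  have := bessel bg (ks n) id x; rewrite sks; apply: le_trans.
  by rewrite lerDr sqr_ge0.
have rle m n x : `|r m n x| <= N x.
  have [nm|mn] := leqP n m.
    rewrite (_ : r m n x = 0) ?normr0 ?(norm_ge0 hN)//.
    have : forall ks' k m', (size ks' <= m')%N -> rademacher g ks' k m' x = 0.
      by elim=> [//|K ks' IH] k [//|m'] /= h; rewrite !IH// addr0 mul0r.
    by apply; rewrite sks.
  rewrite -(@ler_pXn2r _ 2)// ?nnegrE ?normr_ge0 ?(norm_ge0 hN)//.
  rewrite real_normK ?num_real//; apply: le_trans (bes n x).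
  rewrite (bigD1 (Ordinal mn))//= lerDl; apply: sumr_ge0 => i _; exact: sqr_ge0.
pose phi m x := ultralim U (fun n => r m n x).
have cv m x : (fun n => r m n x) @ U --> phi m x by exact: ultralimP (rle m ^~ x).
have Uge m : \forall n \near U, (m < n)%N.
  apply: fU; apply: (@sub_finite_set _ _ `I_m.+1) => [n /= /negP|]; last exact: finite_II.
  by rewrite -leqNgt ltnS.
exists (omega N g / 4); first by rewrite divr_gt0.
exists phi; split.
- move=> m; split=> [a x y|x].
    apply: (@norm_cvg_unique _ R^o ((fun n => r m n (a *: x + y)) @ U)); first exact: cv.
    rewrite (_ : (fun n => _) = (fun n => a * r m n x + r m n y)).
      by apply: cvgD; [apply: cvgM; [exact: cvg_cst|exact: cv]|exact: cv].
    by apply/funext => n; rewrite /r rademacher_lin.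
  apply: (@cvgr_to_le _ U _ _ (fun n => `|r m n x|)).
    exact: (cvg_norm (cv m x)).
  by near=> n.
- move=> m; have [x1 hab _ _ sep] := hD _ (dks m).
  exists (D (ks m)).1.1.1 => //; apply: (@cvgr_to_ge _ U _ _ (r m ^~ (D (ks m)).1.1.1)).
    exact: cv.
  near=> n; have [|rest e] := ksE m n; first by near: n; exact: Uge.
  have := @rademacher_ge g (ks m) rest (D (ks m)).2 id _ _ _ sep.
  by rewrite sks -e /r; apply: le_trans; lra.
- move=> x e e0.
  have cvs m : (fun n => \sum_(i < m) r i n x ^+ 2) @ U --> \sum_(i < m) phi i x ^+ 2.
    elim: m => [|m IH].
      rewrite big_ord0 (_ : (fun n => _) = fun=> 0); first exact: cvg_cst.
      by apply/funext => n; rewrite big_ord0.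
    rewrite big_ord_recr (_ : (fun n => _) =
      (fun n => \sum_(i < m) r i n x ^+ 2 + r m n x ^+ 2)) /=.
      apply: cvgD => //; rewrite !expr2; apply: cvgM; exact: cv.
    by apply/funext => n; rewrite big_ord_recr.
  have bphi m : \sum_(i < m) phi i x ^+ 2 <= N x ^+ 2.
    apply: (@cvgr_to_le _ U _ _ (fun n => \sum_(i < m) r i n x ^+ 2)); first exact: cvs.
    near=> n; apply: le_trans (bes n x).
    have mn : (m <= n)%N by apply: ltnW; near: n; exact: Uge.
    rewrite -(subnKC mn) big_split_ord /= lerDl.
    by apply: sumr_ge0 => i _; exact: sqr_ge0.
  have : cvgn (series (fun i => phi i x ^+ 2)).
    apply: nondecreasing_is_cvgn.
      apply/nondecreasing_seqP => n; rewrite !seriesEnat /= big_nat_recr//= lerDl.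
      exact: sqr_ge0.
    by exists (N x ^+ 2) => _ [n _ <-]; rewrite seriesEnat /= big_mkord.
  move=> /cvg_series_cvg_0/cvgrPdist_lt/(_ (e ^+ 2)); rewrite exprn_gt0// => /(_ isT).
  move=> [n _ hn]; exists n => k nk; have := hn k nk.
  rewrite sub0r normrN ger0_norm ?sqr_ge0// => h.
  by rewrite -(@ltr_pXn2r _ 2)// ?nnegrE// ?(ltW e0)// real_normK ?num_real.
Unshelve. all: by end_near. Qed.

Lemma JN_or_norm_cauchy f (U : set_system nat) : UltraFilter U -> free_filter U ->
  bounded_seq N f ->
  JN_sequence N \/ exists2 h, subrefines N h f & norm_cauchy N h.
Proof.
move=> hU fU bf; have [h hf st] := stabilize_omega hN bf.
have [w0|w0] := leP (omega N h) 0.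
  by have [nc|] := norm_cauchy_or_JN hN hf.2 w0; [right; exists h|left].
by left; apply: stable_JN st => //; exact: hf.2.
Qed.

End RademacherBranch.

(** * Functionals vanishing on norming vectors of earlier averages *)

Section JosefsonNissenzweig.
Context (R : realType) (V : lmodType R) (N : V -> R) (hN : is_norm N).
Hypothesis fdV : ~ finite_dimensional V.
Implicit Types (u v : V -> R) (l : seq (V -> R)).

Definition norming u : V :=
  xget 0 [set z | N z <= 1 /\ forall y, `|u y| <= 2 * u z * N y].

Lemma normingP u : dual_ball N u ->
  N (norming u) <= 1 /\ forall y, `|u y| <= 2 * u (norming u) * N y.
Proof.
move=> du; exact: (xgetPex 0 (near_norming hN (dual_ball_blin du))).
Qed.

(** Finite stages of [midhull], which allow [exists_next] to treat finitely many averages at a time.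
    The number [size l] of rounds used there grows with the list, so every average is eventually
    treated. *)
Fixpoint midpoints d l := if d is d'.+1 then
  midpoints d' l ++ [seq (fun x => (u x + v x) / 2) | u <- midpoints d' l, v <- midpoints d' l]
  else l.

Lemma midpoints_leq d d' l u : (d <= d')%N ->
  List.In u (midpoints d l) -> List.In u (midpoints d' l).
Proof.
elim: d' => [|d' IH]; first by rewrite leqn0 => /eqP ->.
rewrite leq_eqVlt => /orP[/eqP->//|/IH{}IH /IH ?] /=.
by apply/List.in_or_app; left.
Qed.

Lemma In_allpairs (A B C : Type) (F : A -> B -> C) s t c :
  List.In c [seq F a b | a <- s, b <- t] <->
  exists a b, [/\ List.In a s, List.In b t & c = F a b].
Proof.
have In_map (f : B -> C) r : List.In c [seq f b | b <- r] <-> exists2 b, List.In b r & c = f b.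
  elim: r => [|b r IH] /=; first by split=> // -[].
  split=> [[<-|/IH[b' rb' ->]]|[b' [<- ->|rb' cE]]].
  - by exists b => //; left.
  - by exists b' => //; right.
  - by left.
  - by right; apply/IH; exists b'.
elim: s => [|a s IH] /=; first by split=> // -[a [b []]].
split=> [h|[a' [b [[<-|sa] tb cE]]]].
  have [/In_map[b tb ->]|/IH[a' [b [sa tb ->]]]] := List.in_app_or _ _ _ h.
  - by exists a, b; split=> //; left.
  - by exists a', b; split=> //; right.
- by apply/List.in_or_app; left; apply/In_map; exists b.
- by apply/List.in_or_app; right; apply/IH; exists a', b.
Qed.

Lemma midpoints_sub d l l' u : (forall v, List.In v l -> List.In v l') ->
  List.In u (midpoints d l) -> List.In u (midpoints d l').
Proof.
move=> ll'; elim: d u => [|d IH] u /=; first exact: ll'.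
move=> hu; apply/List.in_or_app.
have [/IH ?|/In_allpairs[v [w [vl wl ->]]]] := List.in_app_or _ _ _ hu.
  by left.
by right; apply/In_allpairs; exists v, w; split=> //; exact: IH.
Qed.

Lemma exists_next l : exists f, [/\ dual_ball N f,
  (forall u, List.In u (midpoints (size l) l) -> f (norming u) = 0) &
  exists2 z, N z <= 1 & 1 / 2 <= f z].
Proof.
have [f [df fD [z [z1 fz]]]] :=
  functional_vanishing_on hN fdV (map norming (midpoints (size l) l)).
exists f; split=> //; last by exists z.
move=> u ul; apply: fD.
elim: (midpoints _ _) ul => //= v s IH [->|/IH]; first exact: mem_head.
by rewrite inE orbC => ->.
Qed.

(* Each [f n] vanishes on vectors norming the dyadic averages of the previous
   ones, so that along any averages of the [f n] that converge in norm the
   limit is [0]; hence the [f n] tend to [0] pointwise unless averaging some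
   subsequence yields a Josefson-Nissenzweig sequence directly. *)
Theorem josefson_nissenzweig (U : set_system nat) : UltraFilter U ->
  free_filter U -> JN_sequence N.
Proof.
move=> hU fU; have [next nextP] := choice exists_next.
pose L := fix L n := if n is m.+1 then next (L m) :: L m else [::].
pose f n := next (L n).
have bf : bounded_seq N f by move=> n; have [] := nextP (L n).
have sL n : size (L n) = n by elim: n => //= n ->.
have LS m n u : (m <= n)%N -> List.In u (L m) -> List.In u (L n).
  elim: n => [|n IH]; first by rewrite leqn0 => /eqP ->.
  by rewrite leq_eqVlt => /orP[/eqP->//|/IH{}IH /IH ?]; right.
have hull u : midhull (tail f 0) u -> exists n0, forall n, (n0 <= n)%N -> f n (norming u) = 0.
  move=> hu; have [n0 hn0] : exists n0, forall n, (n0 <= n)%N ->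
      List.In u (midpoints n (L n)).
    elim: hu => [_ [k _ ->]|{}u v _ [n1 h1] _ [n2 h2]].
      exists k.+1 => n kn; apply: (midpoints_leq (leq0n n)) => /=.
      by apply: LS kn _; left.
    (* One more round, since the midpoint of two members of round [n] appears in round [n.+1]. *)
    exists (maxn n1 n2).+1 => -[//|n]; rewrite ltnS geq_max => /andP[/h1 un /h2 vn].
    apply: (midpoints_sub (LS n n.+1 ^~ (leqnSn n))) => /=.
    by apply/List.in_or_app; right; apply/In_allpairs; exists u, v.
  exists n0 => n /hn0 un; have [_ h _] := nextP (L n); apply: h.
  by rewrite sL.
apply: contrapT => nJN.
apply: (nJN); exists (1 / 2); first by rewrite divr_gt0.
exists f; split=> //; first by move=> k; have [_ _ hz] := nextP (L k); exact: hz.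
move=> x0 e e0; apply: contrapT => nn.
have [x fx] : exists x, frequently (fun k => e <= f k x).
  apply: contrapT => h; apply: nn.
  have [n1 h1] : exists n, forall k, (n <= k)%N -> ~ (e <= f k x0).
    by apply: not_frequently => fr; apply: h; exists x0.
  have [n2 h2] : exists n, forall k, (n <= k)%N -> ~ (e <= f k (- x0)).
    by apply: not_frequently => fr; apply: h; exists (- x0).
  exists (maxn n1 n2) => k; rewrite geq_max => /andP[/h1 + /h2].
  rewrite (linN _ (bf k).1) => /negP; rewrite -ltNge => ? /negP; rewrite -ltNge => ?.
  by rewrite ltr_norml; apply/andP; split; lra.
(* On this subsequence all values at [x] are at least [e], hence so are those of all averages of its
   terms. *)
have [k dk hk] := frequently_eventually (n := 0%N) (Q := fun=> True) fx (fun=> (fun=> I)).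
have [JN|[h [rh bh] nh]] := JN_or_norm_cauchy hN hU fU (f := f \o k) (fun n => bf (k n)).
  exact: nJN JN.
have rhf := refines_trans rh (refines_comp f dk).
have Nx := norm_ge0 hN x; have d0 : 0 < e / (4 * (N x + 1)) by rewrite divr_gt0// mulr_gt0//; lra.
have [n1 h1] := nh _ d0; have [n2 h2] := rh 0%N; have [n3 h3] := rhf 0%N.
pose n := maxn n1 (maxn n2 n3).
have /and3P[i1 i2 i3] : [&& n1 <= n, n2 <= n & n3 <= n]%N.
  by rewrite -!geq_max.
have ehx : e <= h n x by apply: midhull_ge (h2 n i2) => _ [i _ ->]; exact: (hk i).1.
have [z1 hz] := normingP (bh n); set z := norming (h n) in z1 hz.
(* From [n0] on every [f i] vanishes at the norming vector [z] of [h n], and so do averages [h l] of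
   such terms. *)
have [n0 hn0] := hull _ (h3 n i3); have [m hm] := rhf n0.
pose l := maxn n1 m.
have hl0 : h l z = 0.
  have hml := hm l (leq_maxr _ _).
  apply/eqP; rewrite eq_le; apply/andP; split.
    by apply: midhull_le hml => _ [i ni ->]; rewrite hn0.
  by apply: midhull_ge hml => _ [i ni ->]; rewrite hn0.
(* Thus [h n z <= d], and the choice of [z] yields [e <= h n x <= 2 * d * N x < e]. *)
have := h1 n l i1 (leq_maxl _ _) z; rewrite hl0 subr0.
have := hz x; have := ler_norm (h n x); have := ler_norm (h n z).
set d := e / _ in d0 *.
have ed : e = d * (4 * (N x + 1)) by rewrite /d divfK// gt_eqF// mulr_gt0//; lra.
move=> a1 a2 a3 a4; have Nz := norm_ge0 hN z.
have b1 : h n z <= d by nra.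
have b2 : h n z * N x <= d * N x by rewrite ler_wpM2r.
nra.
Qed.

End JosefsonNissenzweig.

(** * Almost orthonormal families of functionals *)

Section BesselFamily.
Context (R : realType) (V : lmodType R) (N : V -> R) (hN : is_norm N).
Hypothesis fdV : ~ finite_dimensional V.

(** Cramer's rule for rows: expanding along row [i] leaves the cofactors of [A], and the expansions
    of the other rows with these cofactors vanish. *)
Lemma det_replace_row n (A B : 'M[R]_n) (c : 'rV[R]_n) i :
  (forall l, B i l = \sum_j c 0 j * A j l) ->
  (forall k l, k != i -> B k l = A k l) -> \det B = c 0 i * \det A.
Proof.
move=> Bi Bk; rewrite (expand_det_row B i).
have cofE l : cofactor B i l = cofactor A i l.
  rewrite /cofactor; congr (_ * \det _); apply/matrixP => k m; rewrite !mxE.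
  by apply: Bk; rewrite eq_sym; exact: neq_lift.
under eq_bigr do rewrite cofE Bi mulr_suml.
rewrite exchange_big /= (bigD1 i)//= [X in _ + X]big1 => [|j /negPf ji].
  rewrite addr0; under eq_bigr do rewrite -mulrA.
  by rewrite -mulr_sumr -expand_det_row.
under eq_bigr do rewrite -mulrA.
have := congr1 (fun M : 'M_n => M j i) (mul_mx_adj A); rewrite !mxE ji mulr0n => h.
rewrite -mulr_sumr (_ : \sum_i0 _ = 0) ?mulr0// -[RHS]h.
by apply: eq_bigr => l _; rewrite mxE.
Qed.

(* Choose the phi_i to almost maximize det (phi_i x_j): replacing phi_i by
   another functional of the ball multiplies it by the i-th coordinate of that
   functional, which is therefore at most 2 (an almost Auerbach basis). *)
Lemma near_auerbach n : exists phi : 'I_n -> V -> R,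
  (forall i, dual_ball N (phi i)) /\
  forall (a : 'rV[R]_n) t, 0 < t ->
    (forall x, `|\sum_i a 0 i * phi i x| <= t * N x) -> forall i, `|a 0 i| <= 2 * t.
Proof.
have [e [x [be ex]]] := biorthogonal hN fdV n.
pose gram (phi : 'I_n -> V -> R) : 'M[R]_n := \matrix_(i, j) phi i (x j).
pose S := [set \det (gram phi) | phi in [set phi | forall i, dual_ball N (phi i)]].
have [c hc] : exists c : 'I_n -> R,
    forall i, 0 < c i /\ dual_ball N (fun y => c i * e i y).
  have ex_c (i : 'I_n) : exists c, 0 < c /\ dual_ball N (fun y => c * e i y).
    have [|c c0 [dc _]] := blin_normalize hN (x := x i) (be i (ltn_ord i)).
      by rewrite ex// eqxx; exact/eqP/oner_neq0.
    by exists c.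
  by have [c hc] := choice ex_c; exists c.
have S_pos : exists2 s, S s & 0 < s.
  exists (\prod_i c i); last by apply: prodr_gt0 => i _; exact: (hc i).1.
  exists (fun i y => c i * e i y); first by move=> i; exact: (hc i).2.
  rewrite (_ : gram _ = diag_mx (\row_i c i)).
    by rewrite det_diag; apply: eq_bigr => i _; rewrite mxE.
  apply/matrixP => i j; rewrite !mxE ex//.
  by rewrite (_ : (i == j :> nat) = (i == j))// mulr_natr.
have S_sup : has_sup S.
  split; first by have [s Ss _] := S_pos; exists s.
  exists (\sum_(s : 'S_n) \prod_i N (x (s i))) => _ [phi dphi <-].
  apply: ler_sum => s _; apply: le_trans (ler_norm _) _.
  rewrite normrM normr_prod normrX normrN1 expr1n mul1r.
  by apply: ler_prod => i _; rewrite normr_ge0 mxE (dphi i).2.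
have S0 : 0 < sup S.
  by have [s Ss s0] := S_pos; apply: lt_le_trans s0 _; apply: ub_le_sup => //; case: S_sup.
have [_ [phi dphi <-] hphi] := sup_adherent (divr_gt0 S0 (ltr0Sn R 1)) S_sup.
exists phi; split=> // a t t0 ha i.
have bound (b : 'rV[R]_n) : (forall y, `|\sum_i b 0 i * phi i y| <= t * N y) ->
    b 0 i <= 2 * t.
  (* [psi] lies in the dual ball; put in place of [phi i], it multiplies the determinant by
     [t^-1 * b 0 i], which cannot exceed [2] because the determinant is above half of the
     supremum. *)
  move=> hb; pose psi y := t^-1 * \sum_j b 0 j * phi j y.
  pose chi k := if k == i then psi else phi k.
  have dchi k : dual_ball N (chi k).
    rewrite /chi; case: eqP => // _; split=> [d y w|y].
      rewrite /psi mulrCA -mulrDr; congr (_ * _); rewrite mulr_sumr -big_split /=.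
      by apply: eq_bigr => j _; rewrite (dphi j).1; ring.
    rewrite /psi normrM ger0_norm ?invr_ge0 ?(ltW t0)//.
    by rewrite mulrC ler_pdivrMr// mulrC.
  have : \det (gram chi) <= sup S.
    by apply: ub_le_sup; [case: S_sup|exists chi].
  rewrite (@det_replace_row _ (gram phi) _ (t^-1 *: b) i).
  - rewrite mxE -mulrA mulrC ler_pdivrMr// => h.
    have D0 : 0 < \det (gram phi) by lra.
    rewrite -(ler_pM2r D0); nra.
  - move=> l; rewrite mxE /chi eqxx /psi mulr_sumr.
    by apply: eq_bigr => j _; rewrite !mxE mulrA.
  - by move=> k l /negPf ki; rewrite !mxE /chi ki.
rewrite ler_norml bound// andbT.
suff : (- a) 0 i <= 2 * t by rewrite mxE; lra.
apply: bound => y; rewrite -normrN -sumrN.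
by under eq_bigr do rewrite mxE mulNr opprK.
Qed.

(** * Orthonormal coefficient vectors and widths *)

Section Windows.
Context (M : nat) (phi : 'I_M -> V -> R).
Hypothesis dphi : forall i, dual_ball N (phi i).
Hypothesis auerbach : forall (a : 'rV[R]_M) t, 0 < t ->
  (forall x, `|\sum_i a 0 i * phi i x| <= t * N x) -> forall i, `|a 0 i| <= 2 * t.
Implicit Types (a b u w : 'rV[R]_M) (l : seq 'rV[R]_M).

Definition dot a b := \sum_i a 0 i * b 0 i.

Definition comb a x := \sum_i a 0 i * phi i x.

Lemma dotC a b : dot a b = dot b a.
Proof. by apply: eq_bigr => i _; rewrite mulrC. Qed.

Lemma dotZl c a b : dot (c *: a) b = c * dot a b.
Proof. by rewrite mulr_sumr; apply: eq_bigr => i _; rewrite mxE mulrA. Qed.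

Lemma dot_suml n (c : 'I_n -> R) (u : 'I_n -> 'rV[R]_M) b :
  dot (\sum_j c j *: u j) b = \sum_j c j * dot (u j) b.
Proof.
rewrite /dot; under eq_bigr do rewrite summxE mulr_suml.
rewrite exchange_big /=; apply: eq_bigr => j _; rewrite mulr_sumr.
by apply: eq_bigr => i _; rewrite mxE mulrA.
Qed.

Lemma dot_ge0 a : 0 <= dot a a.
Proof. by apply: sumr_ge0 => i _; rewrite -expr2 sqr_ge0. Qed.

Lemma dot_eq0 a : dot a a = 0 -> a = 0.
Proof.
move=> /eqP; rewrite psumr_eq0 => [/allP h|i _]; last by rewrite -expr2 sqr_ge0.
apply/rowP => i; rewrite mxE; apply/eqP.
by have := h i (mem_index_enum _); rewrite mulf_eq0 orbb.
Qed.

Lemma entry_le1 a i : dot a a = 1 -> `|a 0 i| <= 1.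
Proof.
move=> a1; rewrite -(@ler_pXn2r _ 2)// ?nnegrE// expr1n real_normK ?num_real// -a1.
rewrite /dot (bigD1 i)//= -expr2 lerDl; apply: sumr_ge0 => j _.
by rewrite -expr2 sqr_ge0.
Qed.

Lemma combZ c a x : comb (c *: a) x = c * comb a x.
Proof. by rewrite mulr_sumr; apply: eq_bigr => i _; rewrite mxE mulrA. Qed.

Lemma comb_sum n (c : 'I_n -> R) (u : 'I_n -> 'rV[R]_M) x :
  comb (\sum_j c j *: u j) x = \sum_j c j * comb (u j) x.
Proof.
rewrite /comb; under eq_bigr do rewrite summxE mulr_suml.
rewrite exchange_big /=; apply: eq_bigr => j _; rewrite mulr_sumr.
by apply: eq_bigr => i _; rewrite mxE mulrA.
Qed.

Lemma comb_lin a : lin (comb a).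
Proof.
move=> c x y; rewrite mulr_sumr -big_split /=.
by apply: eq_bigr => i _; rewrite (dphi i).1; ring.
Qed.

Lemma comb_le a x : dot a a = 1 -> `|comb a x| <= M%:R * N x.
Proof.
move=> a1; apply: le_trans (ler_norm_sum _ _ _) _.
rewrite -[M in leRHS]card_ord -sum1_card natr_sum mulr_suml ler_sum// => i _.
by rewrite normrM ler_pM// ?entry_le1// (dphi i).2.
Qed.

(** If [|comb a x| <= t * N x] for all [x], with [t = 1 / (4 M)], the almost Auerbach property
    bounds the entries of [a] by [2 * t], so [dot a a <= M * (2 * t) ^ 2 = 1 / (4 M) < 1]. *)
Lemma comb_ge a : dot a a = 1 -> exists2 x, N x <= 1 & (4 * M%:R)^-1 <= `|comb a x|.
Proof.
move=> a1; have M0 : (0 : R) < M%:R.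
  rewrite ltr0n lt0n; apply/eqP => M0; move/eqP : a1; rewrite /dot big1 ?(eq_sym 0) ?oner_eq0//.
  by move=> i _; have := ltn_ord i; rewrite {2}M0.
have t0 : 0 < (4 * M%:R)^-1 :> R by rewrite invr_gt0 mulr_gt0.
have [x hx] : exists x, (4 * M%:R)^-1 * N x < `|comb a x|.
  apply: contrapT => h; have ha := auerbach (a := a) t0 _.
  have : dot a a <= \sum_(i < M) (2 * (4 * M%:R)^-1) ^+ 2.
    apply: ler_sum => i _; rewrite -expr2 -real_normK ?num_real//.
    rewrite ler_pXn2r ?nnegrE// ?mulr_ge0 ?(ltW t0)//.
    apply: ha => x; rewrite leNgt; apply/negP => lt; apply: h; by exists x.
  rewrite a1 sumr_const card_ord -[_ *+ M]mulr_natr.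
  have M1 : (1 : R) <= M%:R by rewrite ler1n -(ltr0n R).
  have tM : (4 * M%:R)^-1 * M%:R = 1 / 4 :> R by field; lra.
  move: t0 tM; set t := _^-1 => t0 tM; rewrite (_ : _ * M%:R = 4 * t * (t * M%:R)); last by ring.
  rewrite tM.
  have : t <= t * M%:R by rewrite ler_peMr// ltW.
  lra.
have Nx : 0 < N x.
  rewrite lt_def (norm_ge0 hN) andbT; apply/eqP => Nx; move: hx.
  by rewrite (norm_eq0 hN Nx) (lin0 (comb_lin a)) (norm0 hN) mulr0 normr0 ltxx.
exists ((N x)^-1 *: x).
  by rewrite normZ_eq// ger0_norm ?invr_ge0 ?(ltW Nx)// mulVf// gt_eqF.
rewrite (linZ _ _ (comb_lin a)) normrM ger0_norm ?invr_ge0 ?(ltW Nx)//.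
by rewrite [leRHS]mulrC ler_pdivlMr// ltW.
Qed.

Definition ortho l a := forall w, w \in l -> dot a w = 0.

Lemma exists_ortho l : (size l < M)%N -> exists2 a, dot a a = 1 & ortho l a.
Proof.
move=> lM; pose A : 'M[R]_(M, size l) := \matrix_(i, j) (nth 0 l j) 0 i.
have kA : kermx A != 0.
  rewrite -mxrank_eq0 mxrank_ker subn_eq0 -ltnNge.
  by apply: leq_ltn_trans lM; exact: rank_leq_col.
have /rowV0Pn[v /sub_kermxP vA v0] := kA.
have q0 : 0 < dot v v.
  rewrite lt_def dot_ge0 andbT; apply: contra v0 => /eqP/dot_eq0 ->.
  by rewrite eqxx.
exists ((Num.sqrt (dot v v))^-1 *: v).
  rewrite dotZl dotC dotZl mulrA -invfM -expr2 sqr_sqrtr ?dot_ge0//.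
  by rewrite mulVf// gt_eqF.
move=> w wl; have jl : (index w l < size l)%N by rewrite index_mem.
have := congr1 (fun B : 'rV_(size l) => B 0 (Ordinal jl)) vA; rewrite !mxE => h.
rewrite dotZl (_ : dot v w = 0) ?mulr0// -[RHS]h; apply: eq_bigr => i _.
by rewrite mxE /= nth_index.
Qed.

Definition values l := [set `|comb p.1 p.2| | p in
  [set p : 'rV[R]_M * V | [/\ dot p.1 p.1 = 1, N p.2 <= 1 & ortho l p.1]]].

(* The norm of [comb] on the orthogonal of [l], like a Gelfand number. *)
Definition width l := sup (values l).

Lemma values_ub l : ubound (values l) M%:R.
Proof.
move=> _ [[a x] [a1 x1 _] <-] /=; apply: le_trans (comb_le x a1) _.
by rewrite -[leRHS]mulr1 ler_wpM2l.
Qed.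

Lemma has_sup_values l : (size l < M)%N -> has_sup (values l).
Proof.
move=> /exists_ortho[a a1 al]; split; last by exists M%:R; exact: values_ub.
by exists `|comb a 0|, (a, 0) => //=; split=> //; rewrite (norm0 hN).
Qed.

Lemma le_width l a x : dot a a = 1 -> ortho l a -> N x <= 1 -> `|comb a x| <= width l.
Proof.
move=> a1 al x1; apply: ub_le_sup; first by exists M%:R; exact: values_ub.
by exists (a, x).
Qed.

Lemma width_lower l : (size l < M)%N -> (4 * M%:R)^-1 <= width l.
Proof.
move=> /exists_ortho[a a1 al]; have [x x1 h] := comb_ge a1.
by apply: le_trans h _; exact: le_width.
Qed.

Lemma width_upper l : (size l < M)%N -> width l <= M%:R.
Proof. by move=> lM; apply: ge_sup; [case: (has_sup_values lM)|exact: values_ub]. Qed.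

Lemma width_anti l l' : (size l' < M)%N -> {subset l <= l'} -> width l' <= width l.
Proof.
move=> lM ll'; apply: ge_sup; first by case: (has_sup_values lM).
move=> _ [[a x] [a1 x1 ax] <-]; apply: le_width => // w /ll'; exact: ax.
Qed.

Lemma comb_width l a x : (size l < M)%N -> ortho l a ->
  comb a x ^+ 2 <= width l ^+ 2 * dot a a * N x ^+ 2.
Proof.
move=> lM al; have [a0|a0] := eqVneq (dot a a) 0.
  rewrite a0 mulr0 mul0r (dot_eq0 a0) (_ : comb 0 x = 0) ?expr0n//.
  by apply: big1 => i _; rewrite mxE mul0r.
have [x0|x0] := eqVneq (N x) 0.
  by rewrite (norm_eq0 hN x0) (lin0 (comb_lin a)) (norm0 hN) !expr0n mulr0.
have q0 : 0 < dot a a by rewrite lt_def a0 dot_ge0.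
have Nx : 0 < N x by rewrite lt_def x0 norm_ge0.
pose s := Num.sqrt (dot a a); have s0 : 0 < s by rewrite sqrtr_gt0.
have sE : s ^+ 2 = dot a a by rewrite sqr_sqrtr ?dot_ge0.
have := @le_width l (s^-1 *: a) ((N x)^-1 *: x).
rewrite dotZl dotC dotZl mulrA -invfM -expr2 sE mulVf// => /(_ erefl) h.
have : `|comb (s^-1 *: a) ((N x)^-1 *: x)| <= width l.
  apply: h; first by move=> w wl; rewrite dotZl al// mulr0.
  by rewrite normZ_eq// ger0_norm ?invr_ge0 ?(ltW Nx)// mulVf.
rewrite combZ (linZ _ _ (comb_lin a)) mulrA -invfM normrM.
rewrite ger0_norm ?invr_ge0 ?mulr_ge0 ?(ltW s0) ?(ltW Nx)//.
rewrite mulrC ler_pdivrMr ?mulr_gt0// => le.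
have := @lerXn2r _ 2 _ _ _ _ le; rewrite !nnegrE => /(_ (normr_ge0 _)).
rewrite real_normK ?num_real// !exprMn sE mulrA; apply.
by apply: le_trans le; exact: normr_ge0.
Qed.

End Windows.

(** With [M = n * J + 1] this says that [J] halvings bring [M] down to at most [1 / (4 M)]. *)
Lemma window_length n J : J = (2 ^ (n + 4))%N ->
  (4 * (n * J + 1) ^ 2 <= 2 ^ J)%N.
Proof.
move=> JE0; have J0 : (0 < J)%N by rewrite JE0 expn_gt0.
have nlt : (n < 2 ^ n)%N by exact: ltn_expl.
have JE : J = (16 * 2 ^ n)%N by rewrite JE0 expnD mulnC.
have h1 : (n * J + 1 <= 2 ^ n * J)%N by nia.
have h2 : (4 * (n * J + 1) ^ 2 <= 4 * (2 ^ n * J) ^ 2)%N by rewrite leq_mul2l leq_exp2r.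
apply: leq_trans h2 _; rewrite {1}JE0 -expnD -expnM.
rewrite (_ : 4 = 2 ^ 2)%N// -expnD leq_exp2l// JE; lia.
Qed.

(* The widths along a greedy orthonormal sequence of M = n J + 1 vectors are
   between 1 / (4 M) and M, so they cannot be halved J times: some window of
   length n has almost constant width. *)
Theorem bessel_family n : exists psi : nat -> V -> R,
  [/\ (forall i, (i < n)%N -> dual_ball N (psi i)),
      (forall i, (i < n)%N -> exists2 x, N x <= 1 & 1 / 4 <= `|psi i x|) &
      forall x, \sum_(i < n) psi i x ^+ 2 <= N x ^+ 2].
Proof.
pose J := (2 ^ (n + 4))%N; pose M := (n * J + 1)%N.
have [phi [dphi auer]] := near_auerbach M.
have ex_next (l : seq 'rV[R]_M) : exists p : 'rV[R]_M * V, (size l < M)%N ->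
    [/\ dot p.1 p.1 = 1, N p.2 <= 1, ortho l p.1 & width phi l / 2 <= `|comb phi p.1 p.2|].
  have [lM|Ml] := ltnP (size l) M; last by exists (0, 0).
  have w0 : 0 < width phi l.
    apply: lt_le_trans (width_lower dphi auer lM).
    by rewrite invr_gt0 mulr_gt0// ltr0n /M addn1.
  have [_ [p [p1 p2 pl] <-] h] := sup_adherent (divr_gt0 w0 (ltr0Sn R 1)) (has_sup_values dphi lM).
  by exists p => _; split=> //; move: h; rewrite -/(width phi l); lra.
have [next nextP] := choice ex_next.
pose l := fix l m := if m is k.+1 then (next (l k)).1 :: l k else [::].
pose u m := (next (l m)).1.
have sl m : size (l m) = m by elim: m => //= m ->.
have ul k m : (k < m)%N -> u k \in l m.
  elim: m => // m IH; rewrite ltnS leq_eqVlt inE => /orP[/eqP->|/IH->].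
    by rewrite eqxx.
  by rewrite orbT.
have nP m : (m < M)%N -> [/\ dot (u m) (u m) = 1, N (next (l m)).2 <= 1, ortho (l m) (u m)
    & width phi (l m) / 2 <= `|comb phi (u m) (next (l m)).2|].
  by move=> mM; apply: nextP; rewrite sl.
pose s m := width phi (l m).
have s_anti k m : (k <= m)%N -> (m < M)%N -> s m <= s k.
  move=> km mM; apply: width_anti => //; first by rewrite sl.
  elim: m km {mM} => [|m IH]; first by rewrite leqn0 => /eqP ->.
  by rewrite leq_eqVlt => /orP[/eqP->//|/IH h] w /h wl; rewrite inE wl orbT.
have s_low m : (m < M)%N -> (4 * M%:R)^-1 <= s m.
  by move=> mM; apply: width_lower => //; rewrite sl.
have M0 : (0 : R) < M%:R by rewrite ltr0n /M addn1.
have s_gt0 m : (m < M)%N -> 0 < s m.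
  by move=> /s_low; apply: lt_le_trans; rewrite invr_gt0 mulr_gt0.
have [j jJ hj] : exists2 j, (j < J)%N & s (n * j)%N / 2 <= s (n * j.+1)%N.
  apply: contrapT => h.
  have dec j : (j <= J)%N -> (0 < j)%N -> s (n * j)%N * 2 ^+ j < M%:R.
    elim: j => // j IH jJ _.
    have lt : s (n * j.+1)%N < s (n * j)%N / 2.
      by rewrite ltNge; apply/negP => le; apply: h; exists j.
    case: (posnP j) => [j0|j0].
      have : width phi (l 0) <= M%:R.
        by apply: width_upper => //; rewrite sl /M addn1.
      by rewrite j0 expr1 -/(s 0%N); rewrite j0 muln0 in lt; lra.
    apply: lt_trans (IH (ltnW jJ) j0).
    by rewrite exprS mulrA ltr_pM2r ?exprn_gt0//; lra.
  have J0 : (0 < J)%N by rewrite expn_gt0.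
  have := dec J (leqnn _) J0.
  have hM : (n * J < M)%N by rewrite /M addn1.
  have := s_low _ hM; rewrite -div1r ler_pdivrMr ?mulr_gt0// => h1 h2.
  have h3 : (4 * M ^ 2)%:R <= (2 ^ J)%:R :> R by rewrite ler_nat; exact: window_length.
  move: h3; rewrite natrM !natrX.
  have E0 : (0 : R) < 2 ^+ J by rewrite exprn_gt0.
  nra.
pose i0 := (n * j)%N; have nM k : (k < n)%N -> (i0 + k < M)%N.
  by move=> kn; rewrite /i0 /M; nia.
have si : 0 < s i0.
  by apply: s_gt0; rewrite /i0 /M; nia.
(* The width at most halves over the window and each [u] attains half of its width, so dividing by
   the width at the start leaves values of at least [1 / 4]. *)
pose psi k x := (s i0)^-1 * comb phi (u (i0 + k)%N) x.
have bes x : \sum_(k < n) psi k x ^+ 2 <= N x ^+ 2.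
  (* The vector [w] is orthogonal to [l i0], with [dot w w = B] and [comb phi w x = s i0 * B]; so
     [comb_width] reads [(s i0 * B) ^ 2 <= s i0 ^ 2 * B * N x ^ 2]. *)
  pose B := \sum_(k < n) psi k x ^+ 2; rewrite -/B.
  pose w := \sum_(k < n) psi k x *: u (i0 + k)%N.
  have hw : comb phi w x = s i0 * B.
    rewrite comb_sum /B mulr_sumr; apply: eq_bigr => k _.
    by rewrite /psi; set c := comb _ _ _; field; rewrite gt_eqF.
  have ow : ortho (l i0) w.
    move=> v vl; rewrite /w dot_suml big1// => k _.
    have [_ _ + _] := nP (i0 + k)%N (nM _ (ltn_ord k)) => /(_ v) -> //; rewrite ?mulr0//.
    elim: (nat_of_ord k) => [|k' IH]; first by rewrite addn0.
    by rewrite addnS /= inE IH orbT.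
  have qw : dot w w = B.
    rewrite {1}/w dot_suml; apply: eq_bigr => k _; rewrite expr2; congr (_ * _).
    rewrite dotC /w dot_suml (bigD1 k)//= big1 => [|k' k'k].
      by have [-> _ _ _] := nP (i0 + k)%N (nM _ (ltn_ord k)); rewrite mulr1 addr0.
    rewrite (_ : dot _ _ = 0) ?mulr0//.
    have [lt|lt|e] := ltngtP k k'.
    - have [_ _ + _] := nP (i0 + k')%N (nM _ (ltn_ord k')); apply.
      by apply: ul; rewrite ltn_add2l.
    - rewrite dotC; have [_ _ + _] := nP (i0 + k)%N (nM _ (ltn_ord k)); apply.
      by apply: ul; rewrite ltn_add2l.
    - by exfalso; move/eqP : k'k; apply; apply/val_inj.
  have i0M : (size (l i0) < M)%N by rewrite sl /i0 /M; nia.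
  have := comb_width dphi x i0M ow; rewrite hw qw -/(s i0) exprMn => h.
  have B0 : 0 <= B by apply: sumr_ge0 => k _; exact: sqr_ge0.
  move: h; rewrite -mulrA ler_pM2l ?exprn_gt0// expr2 => h.
  have [->|Bn0] := eqVneq B 0; first exact: sqr_ge0.
  by move: h; rewrite ler_pM2l// lt_def Bn0.
exists psi; split=> //.
- move=> k kn; split=> [a x y|x].
    by rewrite /psi (comb_lin dphi); ring.
  rewrite -(@ler_pXn2r _ 2)// ?nnegrE ?(norm_ge0 hN)// real_normK ?num_real//.
  apply: le_trans (bes x); rewrite (bigD1 (Ordinal kn))//= lerDl.
  by apply: sumr_ge0 => i _; exact: sqr_ge0.
- move=> k kn; have [_ x1 _ h] := nP (i0 + k)%N (nM k kn).
  exists (next (l (i0 + k)%N)).2 => //.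
  rewrite /psi normrM ger0_norm ?invr_ge0 ?(ltW si)// [leRHS]mulrC ler_pdivlMr//.
  apply: le_trans h; rewrite -/(s _).
  have : s (n * j.+1)%N <= s (i0 + k)%N by apply: s_anti; rewrite /i0 /M; nia.
  by move: hj; rewrite -/i0; lra.
Qed.

End BesselFamily.

(** * Semi-selective ultrafilters *)

Section GridUnionBound.
Variable L : nat -> nat.
Hypothesis L_gt0 : forall k, (0 < L k)%N.
Implicit Types (t : nat -> nat) (phi : (nat -> nat) -> rat).

Definition upd t k v : nat -> nat := fun j => if j == k then v else t j.

Lemma updC t k v j w : j != k -> upd (upd t k v) j w = upd (upd t j w) k v.
Proof.
move=> jk; apply/funext => i; rewrite /upd.
by case: (eqVneq i j) => // ->; rewrite (negPf jk).
Qed.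

(** The expectation of [phi] when the coordinates below [n] are independent and uniform and the
    others are as in [t]. *)
Fixpoint gridmean n phi t : rat :=
  if n is m.+1 then (\sum_(v < L m) gridmean m phi (upd t m v)) / (L m)%:R else phi t.

Lemma L_rat k : 0 < (L k)%:R :> rat.
Proof. by rewrite ltr0n. Qed.

Lemma gridmean_sum (I : Type) (r : seq I) n (phi : I -> (nat -> nat) -> rat) t :
  gridmean n (fun t => \sum_(i <- r) phi i t) t = \sum_(i <- r) gridmean n (phi i) t.
Proof.
elim: n t => //= n IH t; under eq_bigr do rewrite IH.
by rewrite exchange_big /= mulr_suml.
Qed.

Lemma gridmean_mulr n phi c t :
  gridmean n (fun t => phi t * c) t = gridmean n phi t * c.
Proof.
elim: n t => //= n IH t; under eq_bigr do rewrite IH.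
by rewrite -mulr_suml mulrAC.
Qed.

Lemma gridmean_le n phi c t : (forall t, phi t <= c) -> gridmean n phi t <= c.
Proof.
move=> h; elim: n t => //= n IH t; rewrite ler_pdivrMr ?L_rat//.
apply: (@le_trans _ _ (\sum_(v < L n) c)); first by apply: ler_sum => v _; exact: IH.
by rewrite sumr_const card_ord mulr_natr.
Qed.

Lemma gridmean_upd n phi t k v : (n <= k)%N ->
  gridmean n phi (upd t k v) = gridmean n (fun t => phi (upd t k v)) t.
Proof.
elim: n t => //= n IH t nk; congr (_ / _); apply: eq_bigr => w _.
by rewrite -IH ?(ltnW nk)// updC// ltn_eqF.
Qed.

Lemma gridmean_attained n phi t : (forall k, (t k < L k)%N) ->
  exists2 t', (forall k, (t' k < L k)%N) & phi t' <= gridmean n phi t.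
Proof.
elim: n t => [|n IH] t ht /=; first by exists t.
have [v hv] : exists v : 'I_(L n), gridmean n phi (upd t n v) <=
    (\sum_(v < L n) gridmean n phi (upd t n v)) / (L n)%:R.
  apply: contrapT => h.
  set m := _ / _ in h; have : \sum_(v < L n) m < \sum_(v < L n) gridmean n phi (upd t n v).
    apply: ltr_sum => [|v _]; first by apply/hasP; exists (Ordinal (L_gt0 n)).
    by rewrite ltNge; apply/negP => le; apply: h; exists v.
  by rewrite sumr_const card_ord -mulr_natr /m divfK ?ltxx// gt_eqF ?L_rat.
have [|t' ht' le] := IH (upd t n v); first by move=> k; rewrite /upd; case: eqP => // ->.
by exists t' => //; exact: le_trans hv.
Qed.

Definition thin k (E : (nat -> nat) -> Prop) := forall t v w, (v < L k)%N ->
  (w < L k)%N -> E (upd t k v) -> E (upd t k w) -> v = w.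

(** Given the other coordinates, at most one of the [L k] values of the [k]-th lies in [E]; for this
    the average over it is moved inside those over the lower coordinates. *)
Lemma gridmean_thin n k E t : thin k E -> (k < n)%N ->
  gridmean n (fun t => `[< E t >]%:R) t <= (L k)%:R^-1.
Proof.
move=> tE; elim: n t => //= n IH t; rewrite ltnS leq_eqVlt => /orP[/eqP<-|kn].
  under eq_bigr do rewrite gridmean_upd//.
  rewrite -gridmean_sum -gridmean_mulr; apply: gridmean_le => s.
  rewrite -[leRHS]mul1r ler_wpM2r ?invr_ge0 ?ler0n//.
  have [[v Ev]|nE] := pselect (exists v : 'I_(L k), E (upd s k v)).
    rewrite (bigD1 v)//= big1 => [|w wv]; first by rewrite addr0; case: `[< _ >].
    case: asboolP => // Ew; exfalso; move/eqP : wv; apply.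
    by apply/val_inj; exact: tE Ew Ev.
  rewrite big1 ?ler01// => v _; case: asboolP => // Ev.
  by exfalso; apply: nE; exists v.
rewrite ler_pdivrMr ?L_rat//.
apply: (@le_trans _ _ (\sum_(v < L n) (L k)%:R^-1)).
  by apply: ler_sum => v _; exact: IH.
by rewrite sumr_const card_ord mulr_natr.
Qed.

(** The expected number of events that occur is below [1], so at some grid point none occurs. *)
Lemma grid_avoids n (E : nat -> (nat -> nat) -> Prop) :
  (forall k, (k < n)%N -> thin k (E k)) -> \sum_(k < n) (L k)%:R^-1 < 1 :> rat ->
  exists2 t, (forall k, (t k < L k)%N) & forall k, (k < n)%N -> ~ E k t.
Proof.
move=> tE s1.
have [t ht le] := @gridmean_attained n (fun t => \sum_(k < n) `[< E k t >]%:R)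
  (fun=> 0%N) L_gt0.
exists t => // k kn Ek.
have : (1 : rat) < 1.
  apply: le_lt_trans s1; apply: (@le_trans _ _ (\sum_(k < n) `[< E k t >]%:R)).
    rewrite (bigD1 (Ordinal kn))//= asboolT// lerDl.
    by apply: sumr_ge0 => i _; rewrite ler0n.
  apply: le_trans le _; rewrite gridmean_sum; apply: ler_sum => i _.
  by apply: gridmean_thin; rewrite ?ltn_ord//; exact: tE.
by rewrite ltxx.
Qed.

End GridUnionBound.

Lemma sum_inv_pow2 n : \sum_(k < n) ((2 ^ (k + 2))%N%:R)^-1 < 1 :> rat.
Proof.
suff : \sum_(k < n) ((2 ^ (k + 2))%N%:R)^-1 = 1 / 2 - (2 ^+ n.+1)^-1 :> rat.
  by move=> ->; have : 0 < (2 ^+ n.+1)^-1 :> rat; [rewrite invr_gt0 exprn_gt0|lra].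
elim: n => [|n IH]; first by rewrite big_ord0 expr1; field.
rewrite big_ord_recr /= IH natrX exprD !exprS expr0.
have : 2 ^+ n != 0 :> rat by rewrite expf_neq0 ?pnatr_eq0.
by move: (2 ^+ n) => a a0; field.
Qed.

Section NatUltrafilters.
Context (U : set_system nat) (hU : UltraFilter U) (fU : free_filter U).

#[local] Instance ultra_proper_nat : ProperFilter U := ultra_proper.

Lemma stationary_ultra A : stationary U A <-> U A.
Proof.
split=> [|UA nUA]; first by have [|//] := in_ultra_setVsetC A hU.
by have [x [Ax nAx]] := filter_ex (filterI UA nUA).
Qed.

Lemma ultra_not A : ~ U A -> U (~` A).
Proof. by have [|//] := in_ultra_setVsetC A hU. Qed.

Lemma free_ge n : U [set i | (n <= i)%N].
Proof.
apply: fU; apply: (@sub_finite_set _ _ `I_n) => [i /= /negP|]; last exact: finite_II.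
by rewrite -ltnNge.
Qed.

Lemma ultra_bounded (f : nat -> nat) m :
  (forall n, (f n < m)%N) -> exists2 v, (v < m)%N & U [set n | f n = v].
Proof.
move=> fm; apply: contrapT => h.
suff /filter_ex[n /=] : U [set n | (m <= f n)%N] by rewrite leqNgt fm.
have H v : (v <= m)%N -> U [set n | (v <= f n)%N].
  elim: v => [|v IH vm]; first by move=> _; exact: filterE.
  have := IH (ltnW vm).
  have : U (~` [set n | f n = v]) by apply: ultra_not => Uv; apply: h; exists v.
  apply: filterS2 => n /= nv vn; rewrite ltn_neqAle vn andbT.
  by apply/eqP => e; apply: nv.
exact: H.
Qed.

End NatUltrafilters.

Lemma eta_spec A : infinite_set A -> strictly_increasing (eta A) /\ range (eta A) = A.
Proof.
move=> infA.
have next m : exists n, (m <= n)%N && `[< A n >].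
  apply: contrapT => h; apply: infA.
  apply: (@sub_finite_set _ _ `I_m) => [i Ai /=|]; last exact: finite_II.
  by rewrite ltnNge; apply/negP => mi; apply: h; exists i; rewrite mi; apply/asboolP.
pose nx m := ex_minn (next m).
have nxP m : [/\ (m <= nx m)%N, A (nx m) & forall j, A j -> (m <= j)%N -> (nx m <= j)%N].
  rewrite /nx; case: ex_minnP => n /andP[mn /asboolP An] h; split=> // j Aj mj.
  by apply: h; rewrite mj; apply/asboolP.
pose e := fix e k := if k is j.+1 then nx (e j).+1 else nx 0%N.
have eS k : (e k < e k.+1)%N by have [] := nxP (e k).+1.
have e_incr : strictly_increasing e by apply: homo_ltn => //; exact: ltn_trans.
have e_range : range e = A.
  apply/seteqP; split=> [_ [k _ <-]|a Aa].
    by case: k => [|k]; [have [] := nxP 0%N|have [] := nxP (e k).+1].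
  have [k ak] : exists k, (a <= e k)%N.
    exists a; elim: a {Aa} => // a IH; exact: leq_ltn_trans IH (eS a).
  have : exists k, (a <= e k)%N by exists k.
  move=> exk; have := ex_minnP exk => -[[|j] aj jmin].
    exists 0%N => //; apply/eqP; rewrite eqn_leq aj andbT.
    by have [_ _ h] := nxP 0%N; exact: h.
  exists j.+1 => //; apply/eqP; rewrite eqn_leq aj andbT /=.
  have [_ _ h] := nxP (e j).+1; apply: h => //.
  by rewrite ltnNge; apply/negP => /jmin; rewrite ltnn.
pose P := [set e' | strictly_increasing e' /\ range e' = A].
have exP : exists e', P e' by exists e.
exact: (@xgetPex _ (id : nat -> nat) P exP).
Qed.

Lemma finite_set_bounded (A : set nat) : finite_set A -> exists b, forall i, A i -> (i < b)%N.
Proof.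
move=> /finite_seqP[s ->]; exists (\max_(i <- s) i).+1 => i /= si.
by rewrite ltnS; exact: leq_bigmax_seq.
Qed.

(** [P_plus] gives a [B] in [U] whose elements from [b k] on lie in [A k]. By [rapid_plus] it
    contains a set of [U] whose [k]-th element is at least [b k]. *)
Lemma semi_selective_diagonal U (A : nat -> set nat) : semi_selective U ->
  (forall k, U (A k)) -> (forall k, A k.+1 `<=` A k) ->
  exists c : nat -> nat, [/\ strictly_increasing c, U (range c) & forall k, A k (c k)].
Proof.
move=> [hU fU rap pp] UA dA.
have [|//|B sB BA] := pp A; first by move=> k; exact: iffRL (stationary_ultra hU _) (UA k).
have [b hb] := choice (fun k => finite_set_bounded (BA k)).
(* Dominates [b], and is strictly increasing thanks to the partial sums and the summand [k]. *)
pose f k := (\sum_(j < k.+1) b j + k)%N.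
have f_incr : strictly_increasing f.
  apply: homo_ltn => [|k]; first exact: ltn_trans.
  by rewrite /f [X in (_ < X + _)%N]big_ord_recr /= addnS ltnS; lia.
have [C [/(iffLR (stationary_ultra hU _)) UC CB infC fC]] := rap B f sB f_incr.
have [e_incr e_range] := eta_spec infC.
exists (eta C); split=> //; first by rewrite e_range.
move=> k; apply: contrapT => nA.
have Ce : range (eta C) (eta C k) by exists k.
rewrite e_range in Ce.
have := hb k _ (conj (CB _ Ce) nA); rewrite ltnNge => /negP; apply.
apply: leq_trans (fC k); rewrite /f big_ord_recr /=; lia.
Qed.

(** * Semi-selective ultrafilters satisfy the uniform boundedness principle *)

Section BalancedNeighbourhoods.
Context (K : numFieldType) (Y : tvsType K).

Definition balanced (W : set Y) :=
  forall (a : K) y, `|a| <= 1 -> W y -> W (a *: y).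

Lemma balanced_nbhs (W : set Y) : nbhs 0 W ->
  exists W', [/\ nbhs 0 W', W' `<=` W & balanced W'].
Proof.
move=> W0; have := @scale_continuous K Y (0, 0) W; rewrite scale0r => /(_ W0)[[A B] /= [A0 B0] AB].
have [r /= r0 rA] : exists2 r : K, 0 < r & ball (0 : K^o) r `<=` A by exact/nbhs_ballP.
pose s := r / 2; have s0 : 0 < s by rewrite divr_gt0.
exists [set y | forall a : K, `|a| <= 1 -> W (a *: y)]; split.
- have := nbhs0Z (lt0r_neq0 s0) B0; apply: filterS => _ [b Bb <-] a a1 /=.
  rewrite scalerA; apply: (AB (a * s, b)); split => //=; apply: rA.
  rewrite -ball_normE /= sub0r normrN normrM (gtr0_norm s0).
  apply: (@le_lt_trans _ _ (1 * s)); first by rewrite ler_wpM2r// ltW.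
  by rewrite mul1r /s ltr_pdivrMr// mulr_natr mulr2n ltrDl.
- by move=> y /(_ 1); rewrite normr1 lexx scale1r => /(_ isT).
- move=> a y a1 /= Wy b b1; rewrite scalerA; apply: Wy.
  by rewrite normrM; apply: le_trans (ler_pM _ _ b1 a1) _; rewrite ?mulr1.
Qed.

Lemma balanced_sub_nbhs (W : set Y) : nbhs 0 W ->
  exists W', [/\ nbhs 0 W', (forall y z, W' y -> W' z -> W (y - z)) & balanced W'].
Proof.
move=> W0; have := @sub_continuous Y (0, 0) W; rewrite subr0 => /(_ W0)[[A B] /= [A0 B0] AB].
have [W' [W'0 sub bal]] := balanced_nbhs (filterI A0 B0).
exists W'; split=> // y z /sub[Ay _] /sub[_ Bz]; exact: (AB (y, z)).
Qed.

End BalancedNeighbourhoods.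

Section SemiSelectiveUBP.
Context (K : numFieldType).
Hypothesis arch : forall e : K, 0 < e -> exists n : nat, n.+1%:R^-1 < e.
Context (X Y : tvsType K) (d : X -> X -> K) (hd : complete_invariant_metric d).
Implicit Types (x y z : X).

Let p x := d x 0.

Let dp x y : d x y = p (x - y).
Proof. by rewrite /p -(cim_invariant hd (x - y) 0 y) subrK add0r. Qed.

Let p_ge0 x : 0 <= p x.
Proof. exact: cim_ge0 hd _ _. Qed.

Let p0 : p 0 = 0.
Proof. exact/(cim_eq0 hd). Qed.

Let pN x : p (- x) = p x.
Proof. by rewrite -[- x]sub0r -dp (cim_sym hd). Qed.

Let pD x y : p (x + y) <= p x + p y.
Proof.
have := cim_triangle hd (x + y) y 0; rewrite -/(p _) -/(p y).
by rewrite dp addrK.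
Qed.

Let pMn n x : p (n%:R *: x) <= n%:R * p x.
Proof.
elim: n => [|n IH]; first by rewrite scale0r p0 mul0r.
rewrite -addn1 natrD scalerDl mulrDl scale1r mul1r.
by apply: le_trans (pD _ _) _; rewrite lerD2r.
Qed.

Let nbhs_p (A : set X) : nbhs 0 A <-> exists2 e : K, 0 < e & [set x | p x < e] `<=` A.
Proof.
split=> [/(cim_nbhs hd)[e e0 eA]|[e e0 eA]].
  by exists e => // x /= xe; apply: eA; rewrite /= (cim_sym hd).
by apply/(cim_nbhs hd); exists e => // x; rewrite /= (cim_sym hd); exact: eA.
Qed.

Lemma pow2_arch (e : K) : 0 < e -> exists m : nat, (2 ^+ m)^-1 < e.
Proof.
move=> /arch[m hm]; exists m; apply: le_lt_trans hm.
rewrite lef_pV2 ?posrE ?exprn_gt0//.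
by rewrite -natrX ler_nat; exact: ltn_expl.
Qed.

Let psum (z : nat -> X) (t : nat -> nat) n := \sum_(k < n) (t k)%:R *: z k.

Let psum_tail (z : nat -> X) t m n : (forall k, p ((t k)%:R *: z k) <= (2 ^+ k)^-1) ->
  (m <= n)%N -> p (psum z t n - psum z t m) <= 2 * (2 ^+ m)^-1.
Proof.
move=> h mn.
suff : p (psum z t n - psum z t m) <= 2 * (2 ^+ m)^-1 - 2 * (2 ^+ n)^-1.
  by move/le_trans; apply; rewrite lerBlDr lerDl mulr_ge0 ?invr_ge0 ?exprn_ge0.
elim: n mn => [|n IH]; first by rewrite leqn0 => /eqP ->; rewrite !subrr p0.
rewrite leq_eqVlt => /orP[/eqP->|mn]; first by rewrite !subrr p0.
rewrite /psum big_ord_recr /= addrAC; apply: le_trans (pD _ _) _.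
apply: le_trans (lerD (IH mn) (h n)) _.
rewrite le_eqVlt; apply/orP; left; apply/eqP; rewrite exprS.
have : 2 ^+ n != 0 :> K by rewrite expf_neq0 ?pnatr_eq0.
have : 2 ^+ m != 0 :> K by rewrite expf_neq0 ?pnatr_eq0.
by move: (2 ^+ n) (2 ^+ m) => a b b0 a0; field; rewrite a0 b0.
Qed.

(** The inverses of the [Lg k] sum to less than [1], as the union bound demands. A vector [w] with
    [p w < 1 / Dg k] keeps [p] at most [2 ^- k] on multiples of [w] by up to [Lg k * k.+1]. *)
Let Lg k := (2 ^ (k + 2))%N.
Let Dg k := (2 ^ k * Lg k * k.+1)%N.

Let Dg_gt0 k : (0 < Dg k)%N.
Proof. by rewrite /Dg /Lg !muln_gt0 !expn_gt0. Qed.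

Context (U : set_system nat) (T : nat -> {linear X -> Y}).
Hypothesis T_cont : forall i, continuous (T i).

(* The k-th event [E n k] holds for at most one value of the k-th coordinate of
   the grid, whatever the other ones; the counting bound gives a good grid
   point for each finite stage, and [U] chooses a limit of those. *)
Lemma semi_selective_equicontinuous : semi_selective U ->
  pointwise_F_bounded U T -> F_equicontinuous U T.
Proof.
move=> ssU pb V0 V00; have [hU fU _ _] := ssU.
have PU : ProperFilter U by exact: ultra_proper.
have [V [Vnbhs VV0 Vbal]] := balanced_nbhs V00.
have [W [Wnbhs WV Wbal]] := balanced_sub_nbhs Vnbhs.
have [W1 [W1nbhs W1W W1bal]] := balanced_sub_nbhs Wnbhs.
apply: contrapT => neq.
(* Failure of equicontinuity on the ball of radius [1 / Dg k] puts [A k] into the ultrafilter. *)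
pose A k := [set i | exists2 w, p w < (Dg k)%:R^-1 & ~ V (T i w)].
have UA k : U (A k).
  apply: contrapT => nUA; apply: neq; exists [set x | p x < (Dg k)%:R^-1].
    by apply/nbhs_p; exists (Dg k)%:R^-1; rewrite ?invr_gt0 ?ltr0n.
  have := ultra_not hU nUA; apply: filterS => i nA _ [w pw <-]; apply: VV0.
  by apply: contrapT => nV; apply: nA; exists w.
have dA k : A k.+1 `<=` A k.
  move=> i [w pw nV]; exists w => //; apply: lt_le_trans pw _.
  rewrite lef_pV2 ?posrE ?ltr0n// ler_nat /Dg /Lg.
  by rewrite !leq_mul// leq_exp2l.
have [c [c_incr Uc cA]] := semi_selective_diagonal ssU UA dA.
have [w hw] : exists w : nat -> X, forall k, p (w k) < (Dg k)%:R^-1 /\ ~ V (T (c k) (w k)).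
  have ex k : exists w, p w < (Dg k)%:R^-1 /\ ~ V (T (c k) w).
    by have [w pw nV] := cA k; exists w.
  by have [w hw] := choice ex; exists w.
pose z k := k.+1%:R *: w k.
have pz (t : nat -> nat) k : (t k < Lg k)%N -> p ((t k)%:R *: z k) <= (2 ^+ k)^-1.
  move=> tk; rewrite /z scalerA -natrM; apply: le_trans (pMn _ _) _.
  apply: (@le_trans _ _ ((Lg k * k.+1)%:R * (Dg k)%:R^-1)).
    apply: ler_pM; rewrite ?ler0n ?p_ge0//; last by apply: ltW; exact: (hw k).1.
    by rewrite ler_nat leq_mul2r ltnW.
  rewrite /Dg -mulnA [X in X^-1]natrM invfM mulrCA mulfV ?mulr1 ?natrX//.
  by rewrite pnatr_eq0 muln_eq0 negb_or /Lg -lt0n expn_gt0.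
(* The factor [k.+1] of [z k] cancels here, so thinness depends on [T (c k) (w k)], while avoiding
   these events keeps [T (c k) x] at least of order [k + 1] for the limit vector [x]. *)
pose E n k t := W (k.+1%:R^-1 *: T (c k) (psum z t n)).
have thinE n k : (k < n)%N -> thin Lg k (E n k).
  move=> kn t v v' vL v'L Ev Ev'; apply: contrapT => vv'; have [_ nV] := hw k.
  (* The other terms of the two sums agree. As [|v - v'| >= 1] and [V] is balanced, [T (c k) (w k)]
     itself would lie in [V]. *)
  have : V (((v%:R : K) - v'%:R) *: T (c k) (w k)).
    rewrite [X in V X](_ : _ = k.+1%:R^-1 *: T (c k) (psum z (upd t k v) n) -
        k.+1%:R^-1 *: T (c k) (psum z (upd t k v') n)); first exact: WV.
    rewrite -scalerBr -linearB /psum -sumrB (bigD1 (Ordinal kn))//= big1 => [|j jk].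
      have TZ a u : T (c k) (a *: u) = a *: T (c k) u by rewrite linearZ.
      rewrite addr0 /upd eqxx -scalerBl TZ /z TZ !scalerA; congr (_ *: _).
      by rewrite mulrC mulfK ?pnatr_eq0.
    rewrite /upd (_ : (j == k :> nat) = false) ?subrr//.
    by apply/negP => /eqP jE; move/eqP : jk; apply; apply/val_inj.
  move=> /(Vbal (v%:R - v'%:R)^-1); rewrite scalerA mulVf.
    rewrite scale1r => h; apply: nV; apply: h; rewrite normfV invf_le1.
      have [lt|lt|//] := ltngtP v v'.
        by rewrite distrC -natrB ?(ltnW lt)// normr_nat ler1n subn_gt0.
      by rewrite -natrB ?(ltnW lt)// normr_nat ler1n subn_gt0.
    by rewrite normr_gt0 subr_eq0 eqr_nat; exact/eqP.
  by rewrite subr_eq0 eqr_nat; exact/eqP.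
have Lg_gt0 k : (0 < Lg k)%N by rewrite expn_gt0.
have ex_grid n : exists t : nat -> nat, (forall k, (t k < Lg k)%N) /\
    forall k, (k < n)%N -> ~ E n k t.
  have [|t h1 h2] := grid_avoids Lg_gt0 (thinE n); last by exists t.
  exact: sum_inv_pow2.
have [g hg] := choice ex_grid.
have [t ht] : exists t : nat -> nat, forall k, (t k < Lg k)%N /\ U [set n | g n k = t k].
  have ex k : exists v, (v < Lg k)%N /\ U [set n | g n k = v].
    by have [v vL Uv] := ultra_bounded hU (fun n => (hg n).1 k); exists v.
  by have [t ht] := choice ex; exists t.
have Uagree m : U [set n | forall k, (k < m)%N -> g n k = t k].
  elim: m => [|m IH]; first exact: filterE.
  have := (ht m).2; apply: filterS2 IH => n /= h1 h2 k.
  by rewrite ltnS leq_eqVlt => /orP[/eqP->//|]; exact: h1.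
have tail_t := psum_tail (fun k => pz t k (ht k).1).
have [x hx] : exists x, forall m, p (x - psum z t m) <= 3 * (2 ^+ m)^-1.
  have [|x cvx] := cim_complete hd (u := psum z t).
    move=> e e0; have [m hm] := pow2_arch (divr_gt0 e0 (ltr0Sn K 1)).
    have me : 2 * (2 ^+ m)^-1 < e by rewrite -ltr_pdivlMl// mulrC.
    exists m => i j mi mj; rewrite dp.
    have H i' j' : (m <= i')%N -> (i' <= j')%N -> p (psum z t j' - psum z t i') < e.
      move=> mi' ij'; apply: le_lt_trans (tail_t _ _ ij') _; apply: le_lt_trans me.
      rewrite ler_pM2l// lef_pV2 ?posrE ?exprn_gt0//.
      by rewrite -!natrX ler_nat leq_exp2l.
    by have [ij|/ltnW ji] := leqP i j; [rewrite -pN opprB|]; apply: H.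
  exists x => m.
  have m0 : 0 < (2 ^+ m)^-1 :> K by rewrite invr_gt0 exprn_gt0.
  have : nbhs x [set y | p (x - y) < (2 ^+ m)^-1].
    by apply/(cim_nbhs hd); exists (2 ^+ m)^-1 => // y /=; rewrite dp.
  move=> /cvx[n0 _ hn0]; pose n := maxn n0 m.
  have /= h1 := hn0 n (leq_maxl _ _).
  have h2 := tail_t _ _ (leq_maxr n0 m).
  rewrite -(subrK (psum z t n) x) -addrA; apply: le_trans (pD _ _) _.
  apply: le_trans (lerD (ltW h1) h2) _.
  by rewrite -[X in X + _]mul1r -mulrDl.
have nW1 k : ~ W1 (k.+1%:R^-1 *: T (c k) x).
  move=> W1x; have k1 : `|k.+1%:R^-1| <= 1 :> K.
    by rewrite normfV normr_nat invf_le1 ?ltr0n// ler1n.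
  have : nbhs 0 (T (c k) @^-1` W1).
    by apply: T_cont; rewrite linear0.
  move=> /nbhs_p[r r0 rW1].
  (* Here [r / 5]: [x] is within [3 * 2 ^- m] of the partial sum up to [m], common to [t] and [g n],
     and the tail for [g n] adds at most [2 * 2 ^- m]. *)
  have [m hm] := pow2_arch (divr_gt0 r0 (ltr0Sn K 4)).
  have [n [/= agr kmn]] := filter_ex (filterI (Uagree m) (free_ge fU (maxn k.+1 m))).
  have /andP[kn mn] : (k < n)%N && (m <= n)%N by rewrite -geq_max.
  have tail_g := psum_tail (fun j => pz (g n) j ((hg n).1 j)).
  apply: ((hg n).2 k kn); rewrite /E.
  have : p (x - psum z (g n) n) < r.
    have e : psum z t m = psum z (g n) m.
      by apply: eq_bigr => j _; rewrite agr.
    have := pD (x - psum z t m) (psum z t m - psum z (g n) n).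
    rewrite addrA subrK => /le_lt_trans; apply.
    rewrite -[p (_ - psum z (g n) n)]pN opprB {2}e.
    apply: le_lt_trans (lerD (hx m) (tail_g m n mn)) _.
    by rewrite -mulrDl -natrD -ltr_pdivlMl// mulrC.
  move=> /rW1 /= W1y.
  rewrite (_ : psum z (g n) n = x - (x - psum z (g n) n)); last by rewrite opprB addrC subrK.
  rewrite linearB scalerBr; apply: W1W => //.
  exact: W1bal.
(* Boundedness at [x] puts [s *: T (c k) x] into [W1] for some [k] with [k.+1%:R^-1 <= s], contrary
   to [nW1] as [W1] is balanced. *)
have [s s0 Us] := pb x W1 W1nbhs; have [k0 hk0] := arch s0.
have [i [[/= W1s [k _ ci]]]] := filter_ex (filterI (filterI Us Uc) (free_ge fU (c k0).+1)).
rewrite /= -ci => ck.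
have k0k : (k0 < k)%N.
  rewrite ltnNge; apply/negP; rewrite leq_eqVlt => /orP[/eqP e|/c_incr].
    by rewrite e ltnn in ck.
  by rewrite ltnNge (ltnW ck).
apply: (nW1 k); rewrite -ci in W1s.
rewrite (_ : k.+1%:R^-1 *: _ = (k.+1%:R^-1 / s) *: (s *: T (c k) x)); last first.
  by rewrite scalerA divfK// gt_eqF.
apply: W1bal => //; rewrite ger0_norm ?divr_ge0 ?invr_ge0 ?ler0n ?(ltW s0)//.
rewrite ler_pdivrMr// mul1r; apply: le_trans (ltW hk0).
by rewrite lef_pV2 ?posrE ?ltr0n// ler_nat ltnS ltnW.
Qed.

End SemiSelectiveUBP.

(** * The uniform boundedness principle implies semi-selectivity *)

Section UBPImpliesSemiSelective.
Context (R : realType) (V : lmodType R) (N : V -> R) (hN : is_norm N).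
Hypothesis fdV : ~ finite_dimensional V.
Context (U : set_system nat) (hU : UltraFilter U) (fU : free_filter U).
Hypothesis ubp : forall f : nat -> V -> R, (forall i, blin N (f i)) ->
  (forall x, exists M, U [set i | `|f i x| <= M]) ->
  exists M, U [set i | forall x, `|f i x| <= M * N x].

Let PU : ProperFilter U := @ultra_proper _ U hU.

Lemma exists_nat_ge (a : R) : exists n : nat, a <= n%:R.
Proof.
exists (Num.Def.truncn a).+1; have [a0|a0] := leP 0 a; last by rewrite ltW// (lt_trans a0).
by apply/ltW; have /andP[] := Num.Theory.truncn_itv a0.
Qed.

Lemma ubp_P_plus : P_plus U.
Proof.
move=> A sA dA; have UA k : U (A k) := iffLR (stationary_ultra hU _) (sA k).
apply: contrapT => nB.
(* Otherwise the intersection itself would be as required by [P_plus]. So along [U] each [i] leaves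
   the decreasing sequence at a first index [k i]. *)
have nUI : ~ U (\bigcap_k A k).
  move=> UI; apply: nB; exists (\bigcap_k A k); first exact: iffRL (stationary_ultra hU _) UI.
  move=> k; rewrite /almost_subset (_ : _ `\` _ = set0)//.
  by apply/seteqP; split=> // i [Ai nAi]; apply: nAi; exact: Ai.
have U0 := ultra_not hU nUI.
have dA' m n : (m <= n)%N -> A n `<=` A m.
  elim: n => [|n IH]; first by rewrite leqn0 => /eqP ->.
  by rewrite leq_eqVlt => /orP[/eqP->//|/IH h] i /dA; exact: h.
have ex_k i : exists k, ~ (\bigcap_k A k) i ->
    ~ A k i /\ forall m, ~ A m i -> (k <= m)%N.
  have [AI|nAI] := pselect ((\bigcap_k A k) i); first by exists 0%N.
  have exm : exists m, `[< ~ A m i >].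
    apply: contrapT => h; apply: nAI => m _; apply: contrapT => nA; apply: h.
    by exists m; apply/asboolP.
  have := ex_minnP exm => -[k /asboolP nA kmin]; exists k => _; split=> // m nAm.
  by apply: kmin; apply/asboolP.
have [k hk] := choice ex_k.
have [c c0 [phi [bphi cphi nphi]]] := josefson_nissenzweig hN fdV hU fU.
have [|x|M UM] := ubp (f := fun i x => (k i).+1%:R * phi i x).
- by move=> i; apply: blinZ; exact: dual_ball_blin (bphi i).
(* If the values at [x] exceed [1] along [U], the set where they do, outside the intersection, is as
   required: off [A m] one has [k i <= m], so [|phi i x| > 1 / (m + 1)], which happens for finitely
   many [i]. *)
- exists 1; apply: contrapT => nU1; apply: nB.
  exists ([set i | 1 < `|(k i).+1%:R * phi i x|] `&` ~` \bigcap_k A k).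
    apply: iffRL (stationary_ultra hU _) _; apply: filterI => //.
    have := ultra_not hU nU1; apply: filterS => i /= /negP.
    by rewrite -ltNge.
  move=> m; have [|n hn] := nphi x m.+1%:R^-1 _; first by rewrite invr_gt0.
  apply: (@sub_finite_set _ _ `I_n); last exact: finite_II.
  move=> i [[/= gt1 nAI] nAm]; rewrite ltnNge; apply/negP => ni.
  have [_ kmin] := hk i nAI; have km := kmin m nAm.
  have := hn i ni; rewrite -[_^-1]mul1r ltr_pdivlMr// => lt1.
  have : `|(k i).+1%:R * phi i x| < 1; last by move=> /(lt_trans gt1); rewrite ltxx.
  rewrite normrM normr_nat mulrC; apply: le_lt_trans lt1.
  by rewrite ler_wpM2l// ler_nat ltnS.
(* A uniform bound [M] forces [k i < M / c], whereas [k i > m] on [A m] outside the intersection. *)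
have [m hm] := exists_nat_ge (M / c).
have [i [[/= hM nAI] Am]] := filter_ex (filterI (filterI UM U0) (UA m)).
have [z z1 cz] := cphi i; have := hM z; rewrite normrM normr_nat => hMz.
have [nA _] := hk i nAI.
have km : (m < k i)%N by rewrite ltnNge; apply/negP => km; apply: nA; exact: dA' km _ Am.
have : (k i).+1%:R * c <= M.
  have Nz := norm_ge0 hN z; have p0 : 0 <= `|phi i z| by [].
  have h1 : (k i).+1%:R * c <= (k i).+1%:R * `|phi i z|.
    by rewrite ler_wpM2l// (le_trans cz)// ler_norm.
  have h2 : 0 < (k i).+1%:R * c by rewrite mulr_gt0.
  have M0 : 0 < M by nra.
  by apply: le_trans h1 _; apply: le_trans hMz _; rewrite ger_pMr.
have : m%:R < (k i).+1%:R :> R by rewrite ltr_nat ltnW.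
by rewrite -ler_pdivlMr// => ? ?; lra.
Qed.

Lemma ubp_rapid_plus : rapid_plus U.
Proof.
move=> I f sI f_incr; have UI := iffLR (stationary_ultra hU _) sI.
apply: contrapT => nB.
(* Bounds the number of exceptional indices in blocks [0] to [n], block [m] having at most
   [(m + 1) ^ 2] of them and ending before [f (G m.+1)]. Below, [b i] is the block of [i]. *)
pose G n := (\sum_(m < n.+1) m.+1 ^ 2)%N.
have f_ge k : (k <= f k)%N.
  by elim: k => // k IH; apply: leq_ltn_trans IH _; exact: f_incr.
have f_le : {homo f : m n / (m <= n)%N}.
  by move=> m n; rewrite leq_eqVlt => /orP[/eqP->//|/f_incr/ltnW].
have G_ge n : (n < G n)%N.
  elim: n => [|n IH]; first by rewrite /G big_ord1.
  rewrite /G big_ord_recr /= -/(G n) -[n.+1]addn1.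
  by apply: (@leq_trans (G n + 1)%N); [rewrite addn1 !addn1|rewrite leq_add2l expn_gt0].
have G_le : {homo G : m n / (m <= n)%N}.
  move=> m n mn; rewrite /G -(subnKC (_ : m.+1 <= n.+1)%N)// big_split_ord /=.
  exact: leq_addr.
have ex_b i : exists b, (i < f (G b.+1))%N /\ forall m, (i < f (G m.+1))%N -> (b <= m)%N.
  have exm : exists m, (i < f (G m.+1))%N.
    exists i; apply: leq_trans (f_ge _); apply: ltn_trans (G_ge _); exact: ltnSn.
  by have := ex_minnP exm => -[b ib bmin]; exists b.
have [b hb] := choice ex_b.
have [psi hpsi] := choice (bessel_family hN fdV).
pose T i x := (b i).+1%:R * psi (f (G (b i).+1)) i x.
have [|x|M UM] := ubp (f := T).
- move=> i; apply: blinZ; apply: dual_ball_blin.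
  by have [h _ _] := hpsi (f (G (b i).+1)); exact/h/(hb i).1.
- exists (N x); apply: contrapT => nUx; apply: nB.
  have UD := ultra_not hU nUx.
  (* Removing the indices below [f (G 0)] settles the positions [k < G 0], to which the count does
     not apply. *)
  pose B := ~` [set i | `|T i x| <= N x] `&` I `&` [set i | (f (G 0%N) <= i)%N].
  have UB : U B by apply: filterI; [exact: filterI|exact: free_ge].
  have infB : infinite_set B.
    move=> finB; have := fU (A := ~` B); rewrite setCK => /(_ finB) UnB.
    by have [i [Bi nBi]] := filter_ex (filterI UB UnB).
  exists B; split=> //; [exact: iffRL (stationary_ultra hU _) UB|by move=> i [[]]|].
  have [e_incr e_range] := eta_spec infB.
  (* If [eta B k < f k] and [G n <= k < G n.+1], the first [k + 1] elements of [B] are exceptional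
     indices in blocks [0] to [n], of which there are at most [G n <= k]. *)
  move=> k; rewrite leqNgt; apply/negP => ek.
  have eB l : B (eta B l) by rewrite -[X in X _]e_range; exists l.
  have [kG|Gk] := ltnP k (G 0).
    have [_ /= h] := eB k; have := leq_ltn_trans h ek.
    by rewrite ltnNge f_le// ltnW.
  have [n /andP[nk kn]] : exists n, (G n <= k < G n.+1)%N.
    have exn : exists n, (k < G n.+1)%N by exists k; exact: ltn_trans (G_ge _).
    have := ex_minnP exn => -[[|n] kn nmin]; first by exists 0%N; rewrite Gk.
    exists n.+1; rewrite kn andbT leqNgt; apply/negP => /nmin.
    by rewrite ltnn.
  pose bad m := [seq i <- iota 0 (f (G m.+1)) | (b i == m) && (N x < `|T i x|)].
  have size_bad m : (size (bad m) <= m.+1 ^ 2)%N.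
    have [_ _ bes] := hpsi (f (G m.+1)); have Nx := norm_ge0 hN x.
    have [N0|N0] := eqVneq (N x) 0.
      rewrite /bad (@eq_in_filter _ _ pred0) ?filter_pred0// => i.
      rewrite mem_iota add0n => /andP[_ iF]; apply/negP => /andP[_].
      rewrite (norm_eq0 hN N0) (norm0 hN) /T.
      have [h _ _] := hpsi (f (G (b i).+1)); have [lin _] := h i (hb i).1.
      by rewrite (lin0 lin) mulr0 normr0 ltxx.
    have {}Nx : 0 < N x by rewrite lt_def N0.
    (* Each bad index contributes at least [N x ^ 2 / (m + 1) ^ 2] to the sum in Bessel's
       inequality. *)
    have : (size (bad m))%:R * (N x ^+ 2 / m.+1%:R ^+ 2) <= N x ^+ 2.
      apply: le_trans (bes x); rewrite -(big_mkord xpredT (fun i => psi _ i x ^+ 2)).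
      rewrite /index_iota subn0 (bigID (fun i => (b i == m) && (N x < `|T i x|))) /=.
      rewrite -[leLHS]addr0 lerD//; last by apply: sumr_ge0 => i _; exact: sqr_ge0.
      rewrite -big_filter -/(bad m) mulr_natl -count_predT -iter_addr_0 -big_const_seq.
      rewrite big_seq [leRHS]big_seq; apply: ler_sum => i; rewrite mem_filter.
      move=> /andP[/andP[/eqP bi]]; rewrite /T bi normrM normr_nat => lt _.
      rewrite -[leRHS]real_normK ?num_real// -expr_div_n.
      rewrite ler_pXn2r ?nnegrE ?divr_ge0 ?(ltW Nx)//.
      by rewrite ler_pdivrMr// mulrC ltW.
    rewrite mulrA ler_pdivrMr ?exprn_gt0// [leRHS]mulrC ler_pM2r ?exprn_gt0//.
    by rewrite -natrX ler_nat.
  have : (k.+1 <= size (flatten [seq bad m | m <- iota 0 n.+1]))%N.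
    rewrite -[X in (X <= _)%N](size_iota 0) -(size_map (eta B)).
    apply: uniq_leq_size.
      rewrite map_inj_uniq ?iota_uniq// => l l' e.
      have [lt|lt|//] := ltngtP l l'.
        by have := e_incr _ _ lt; rewrite e ltnn.
      by have := e_incr _ _ lt; rewrite e ltnn.
    move=> y /mapP[l]; rewrite mem_iota add0n ltnS => /andP[_ lk] ->.
    have el : (eta B l < f k)%N.
      apply: leq_ltn_trans ek; move: lk; rewrite leq_eqVlt => /orP[/eqP->//|].
      by move=> /e_incr/ltnW.
    apply/flatten_mapP; exists (b (eta B l)).
      rewrite mem_iota add0n ltnS /=; apply: (hb _).2.
      by apply: ltn_trans el _; exact: f_incr.
    rewrite mem_filter mem_iota add0n eqxx (hb _).1 !andbT /=.
    have [[/negP + _] _] := eB l; by rewrite -ltNge.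
  apply/negP; rewrite -ltnNge ltnS; apply: leq_trans nk.
  rewrite size_flatten /shape -map_comp sumnE big_map /G -(big_mkord xpredT (fun m => m.+1 ^ 2)%N).
  by rewrite /index_iota subn0; apply: leq_sum => m _; exact: size_bad.
(* Since the [psi] have norm at least [1 / 4], a uniform bound [M] forces [b i < 4 * M], while
   [b i > m] from [f (G m.+1)] on. *)
have [m hm] := exists_nat_ge (4 * M).
have [i [/= hM im]] := filter_ex (filterI UM (free_ge fU (f (G m.+1)))).
have [hd hz _] := hpsi (f (G (b i).+1)).
have [z z1 cz] := hz i (hb i).1; have := hM z; rewrite /T normrM normr_nat => hMz.
have bm : (m < b i)%N.
  rewrite ltnNge; apply/negP => bm.
  have := leq_trans (hb i).1 (f_le _ _ (G_le _ _ (bm : (b i).+1 <= m.+1)%N)).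
  by rewrite ltnNge im.
have : m%:R < (b i).+1%:R :> R by rewrite ltr_nat ltnW.
have Nz := norm_ge0 hN z.
have h1 : (b i).+1%:R * (1 / 4) <= (b i).+1%:R * `|psi (f (G (b i).+1)) i z|.
  by rewrite ler_wpM2l.
have b0 : 0 < (b i).+1%:R :> R by [].
have M0 : 0 < M by nra.
have : M * N z <= M by rewrite ger_pMr.
lra.
Qed.

Lemma ubp_semi_selective : semi_selective U.
Proof. by split=> //; [exact: ubp_rapid_plus|exact: ubp_P_plus]. Qed.

End UBPImpliesSemiSelective.

(** * Real and complex scalars *)

(* Norms in the library are valued in [K]; [nm] is the modulus as a real
   number. The last field is [f x - i f (i x)] over the complex numbers, where
   [j = i], and [f] itself over the reals, where [j = 1]. *)
Record scalar_structure (R : realType) (K : numFieldType) (iota : {rmorphism R -> K})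
    (nm : K -> R) (j : K) : Prop := ScalarStructure {
  iota_le : forall a b, (iota a <= iota b) = (a <= b) ;
  iota_nm : forall z, iota (nm z) = `|z| ;
  scalar_complete : forall u : nat -> K,
    (forall e, 0 < e -> exists n, forall k l, (n <= k)%N -> (n <= l)%N -> nm (u k - u l) < e) ->
    exists v, forall e, 0 < e -> exists n, forall k, (n <= k)%N -> nm (u k - v) < e ;
  complexify : forall (X : lmodType K) (f : X -> R),
    (forall a x y, f (iota a *: x + y) = a * f x + f y) ->
    exists T : X -> K, (forall (a : K) x y, T (a *: x + y) = a * T x + T y) /\
      forall x, `|f x| <= nm (T x) <= `|f x| + `|f (j *: x)| }.

Section Scalars.
Context (R : realType).

Lemma real_complete (u : nat -> R) :
  (forall e, 0 < e -> exists n, forall k l, (n <= k)%N -> (n <= l)%N -> `|u k - u l| < e) ->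
  exists v, forall e, 0 < e -> exists n, forall k, (n <= k)%N -> `|u k - v| < e.
Proof.
move=> cu; have /cvg_ex[v uv] : cvgn u.
  apply/cauchy_cvgP/cauchy_exP => e e0; have [n hn] := cu e e0.
  exists (u n); exists n => // k nk /=; rewrite /ball /=; exact: hn.
exists v => e e0; move/cvgrPdist_lt : uv => /(_ e e0)[n _ hn]; exists n => k nk.
by rewrite distrC; exact: hn.
Qed.

Lemma scalar_structure_real :
  @scalar_structure R R (idfun : {rmorphism R -> R}) (fun z => `|z|) 1.
Proof.
split=> //; first exact: real_complete.
move=> X f lf; exists f; split=> // x.
by rewrite lexx lerDl normr_ge0.
Qed.

Lemma sqrt_norm_bounds (a b : R) :
  [/\ `|a| <= Num.sqrt (a ^+ 2 + b ^+ 2), `|b| <= Num.sqrt (a ^+ 2 + b ^+ 2) &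
      Num.sqrt (a ^+ 2 + b ^+ 2) <= `|a| + `|b|].
Proof.
split.
- by rewrite -sqrtr_sqr ler_wsqrtr// lerDl sqr_ge0.
- by rewrite -sqrtr_sqr ler_wsqrtr// lerDr sqr_ge0.
- rewrite -[leRHS]ger0_norm ?addr_ge0// -sqrtr_sqr ler_wsqrtr// sqrrD.
  rewrite !real_normK ?num_real// addrAC -addrA lerD2l lerDl.
  by rewrite mulrn_wge0// mulr_ge0.
Qed.

Lemma scalar_structure_complex :
  @scalar_structure R R[i] (real_complex R : {rmorphism R -> R[i]})
    (fun z => Num.sqrt (complex.Re z ^+ 2 + complex.Im z ^+ 2)) (Complex 0 1).
Proof.
split.
- exact: lecR.
- by move=> z; rewrite normc_def.
- move=> u cu.
  have [a ha] : exists v, forall e, 0 < e -> exists n, forall k, (n <= k)%N ->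
      `|complex.Re (u k) - v| < e.
    apply: (@real_complete (fun k => complex.Re (u k))) => e e0.
    have [n hn] := cu e e0; exists n => k l nk nl.
    apply: le_lt_trans (hn k l nk nl); rewrite (_ : _ - _ = complex.Re (u k - u l)).
      by have [] := sqrt_norm_bounds (complex.Re (u k - u l)) (complex.Im (u k - u l)).
    by case: (u k) (u l) => [? ?] [? ?].
  have [b hb] : exists v, forall e, 0 < e -> exists n, forall k, (n <= k)%N ->
      `|complex.Im (u k) - v| < e.
    apply: (@real_complete (fun k => complex.Im (u k))) => e e0.
    have [n hn] := cu e e0; exists n => k l nk nl.
    apply: le_lt_trans (hn k l nk nl); rewrite (_ : _ - _ = complex.Im (u k - u l)).
      by have [] := sqrt_norm_bounds (complex.Re (u k - u l)) (complex.Im (u k - u l)).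
    by case: (u k) (u l) => [? ?] [? ?].
  exists (Complex a b) => e e0; have e2 : 0 < e / 2 by rewrite divr_gt0.
  have [n1 h1] := ha _ e2; have [n2 h2] := hb _ e2; exists (maxn n1 n2) => k.
  rewrite geq_max => /andP[/h1 k1 /h2 k2].
  have [_ _ h] := sqrt_norm_bounds (complex.Re (u k - Complex a b))
    (complex.Im (u k - Complex a b)).
  apply: le_lt_trans h _.
  have -> : complex.Re (u k - Complex a b) = complex.Re (u k) - a by case: (u k).
  have -> : complex.Im (u k - Complex a b) = complex.Im (u k) - b by case: (u k).
  lra.
- move=> X f lf; have f0 : f 0 = 0.
    by have := lf 1 0 0; rewrite scaler0 addr0; lra.
  have fZ a x : f (real_complex R a *: x) = a * f x.
    by have := lf a x 0; rewrite !addr0 f0 addr0.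
  have fD x y : f (x + y) = f x + f y by have := lf 1 x y; rewrite rmorph1 scale1r mul1r.
  pose J : R[i] := Complex 0 1.
  have JJ : J * J = -1 by rewrite -expr2 sqr_i.
  have fE (a : R[i]) x : f (a *: x) = complex.Re a * f x + complex.Im a * f (J *: x).
    by rewrite {1}[a]complexE scalerDl -/J mulrC -scalerA fD !fZ.
  exists (fun x => Complex (f x) (- f (J *: x))); split=> [a x y|x] /=; last first.
    have [h _ h'] := sqrt_norm_bounds (f x) (- f (J *: x)).
    by rewrite h /=; rewrite normrN in h'.
  have e1 : f (a *: x + y) = complex.Re a * f x + complex.Im a * f (J *: x) + f y.
    by rewrite fD fE.
  have e2 : f (J *: (a *: x + y)) = complex.Re a * f (J *: x) - complex.Im a * f x + f (J *: y).
    rewrite scalerDr fD scalerA mulrC -scalerA fE scalerA JJ.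
    by rewrite (_ : -1 = real_complex R (-1)) ?fZ ?rmorphN1//; ring.
  rewrite e1 e2; case: a {e1 e2} => b c; apply/eqP; rewrite eq_complex /=.
  by apply/andP; split; apply/eqP; ring.
Qed.

End Scalars.

Lemma scalar_fieldP (R : realType) (K : numFieldType) : scalar_field R K ->
  exists (iota : {rmorphism R -> K}) nm j, scalar_structure iota nm j.
Proof.
case; first by exists idfun, (fun z => `|z|), 1; exact: scalar_structure_real.
by do 3 eexists; exact: scalar_structure_complex.
Qed.

(** A fresh name for the carrier, so that the restricted real scalar multiplication does not clash
    with the one over [K]. *)
Definition realified (R : realType) (K : numFieldType) (iota : {rmorphism R -> K})
  (X : lmodType K) : Type := X.

Section Realified.
Context (R : realType) (K : numFieldType) (iota : {rmorphism R -> K}) (X : lmodType K).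
Notation XR := (realified iota X).

HB.instance Definition _ := GRing.Zmodule.copy XR X.

Let rscale (a : R) (x : XR) : XR := iota a *: (x : X).

Let rscaleA a b (x : XR) : rscale a (rscale b x) = rscale (a * b) x.
Proof. by rewrite /rscale scalerA rmorphM. Qed.

Let rscale1 : left_id 1 rscale.
Proof. by move=> x; rewrite /rscale rmorph1 scale1r. Qed.

Let rscaleDr : right_distributive rscale +%R.
Proof. by move=> a x y; rewrite /rscale scalerDr. Qed.

Let rscaleDl (x : XR) : {morph rscale^~ x : a b / a + b}.
Proof. by move=> a b; rewrite /rscale rmorphD scalerDl. Qed.

HB.instance Definition _ :=
  GRing.Zmodule_isLmodule.Build R XR rscaleA rscale1 rscaleDr rscaleDl.

Lemma realified_scale (a : R) (x : XR) : a *: x = (iota a *: (x : X) : X).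
Proof. by []. Qed.

Lemma realified_infinite : ~ finite_dimensional X -> ~ finite_dimensional XR.
Proof.
move=> fdX [n [e he]]; apply: fdX; exists n, e => x; have [c xc] := he x.
by exists (fun i => iota (c i)).
Qed.

End Realified.

Section Transfer.
Context (R : realType) (K : numFieldType) (iota : {rmorphism R -> K}) (nm : K -> R) (j : K).
Hypothesis hK : scalar_structure iota nm j.

Lemma iota_lt a b : (iota a < iota b) = (a < b).
Proof. by rewrite !lt_def (iota_le hK) (inj_eq (fmorph_inj iota)). Qed.

Lemma iota_ge0 a : (0 <= iota a) = (0 <= a).
Proof. by rewrite -(iota_le hK) rmorph0. Qed.

Lemma iota_gt0 a : (0 < iota a) = (0 < a).
Proof. by rewrite -iota_lt rmorph0. Qed.

Lemma nm_iota z : `|z| = iota (nm z).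
Proof. by rewrite (iota_nm hK). Qed.

Lemma iota_nm_ge0 z : 0 <= z -> iota (nm z) = z.
Proof. by move=> z0; rewrite (iota_nm hK) ger0_norm. Qed.

Lemma nm_ge0 z : 0 <= nm z.
Proof. by rewrite -iota_ge0 (iota_nm hK). Qed.

Lemma nm0 : nm 0 = 0.
Proof. by apply: (fmorph_inj iota); rewrite (iota_nm hK) normr0 rmorph0. Qed.

Lemma nmM a b : nm (a * b) = nm a * nm b.
Proof. by apply: (fmorph_inj iota); rewrite rmorphM !(iota_nm hK) normrM. Qed.

Lemma nmD a b : nm (a + b) <= nm a + nm b.
Proof. by rewrite -(iota_le hK) rmorphD !(iota_nm hK) ler_normD. Qed.

Lemma norm_iota a : `|iota a| = iota `|a|.
Proof.
have [a0|a0] := leP 0 a; first by rewrite !ger0_norm ?iota_ge0.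
by rewrite -normrN -raddfN ger0_norm ?iota_ge0 ?oppr_ge0 ?(ltW a0)// ltr0_norm.
Qed.

Lemma scalar_archimedean (e : K) : 0 < e -> exists n : nat, n.+1%:R^-1 < e.
Proof.
move=> e0; have := iota_nm_ge0 (ltW e0); move: (nm e) => a ea.
rewrite -{e}ea iota_gt0 in e0 *.
have := e0; rewrite -subr_gt0 subr0 => /ltr_add_invr[n]; rewrite add0r => hn.
by exists n; rewrite -(rmorph_nat iota) -fmorphV iota_lt.
Qed.

Context (X : normedModType K).
Notation XR := (realified iota X).

Definition rnorm (x : XR) : R := nm `|(x : X)|.

Lemma iota_rnorm x : iota (rnorm x) = `|(x : X)|.
Proof. by rewrite iota_nm_ge0. Qed.

Lemma is_norm_rnorm : is_norm rnorm.
Proof.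
split=> [x y|a x|x].
- by rewrite -(iota_le hK) rmorphD !iota_rnorm; exact: ler_normD.
- by apply: (fmorph_inj iota); rewrite rmorphM !iota_rnorm realified_scale normrZ norm_iota.
- move=> /(congr1 iota); rewrite iota_rnorm rmorph0 => /eqP.
  by rewrite normr_eq0 => /eqP.
Qed.

Lemma complexified_functional (f : XR -> R) : blin rnorm f ->
  exists2 T : {linear X -> K^o}, continuous T &
    forall x, `|f x| <= nm (T x) <= `|f x| + `|f (j *: (x : X))|.
Proof.
move=> [M [lf hf]]; have [T [lT hT]] := complexify hK lf.
pose TL := GRing.isLinear.Build K X K^o *:%R T lT.
pose T' : {linear X -> K^o} := HB.pack T TL.
exists T' => //; apply: bounded_linear_continuous; apply/bounded_funP => r.
exists (iota (`|M| * (1 + nm j)) * r) => x xr.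
have xr' : iota (rnorm x) <= r by rewrite iota_rnorm.
apply: le_trans (_ : _ <= iota (`|M| * (1 + nm j)) * iota (rnorm x)) _; last first.
  by rewrite ler_wpM2l// iota_ge0 mulr_ge0// addr_ge0// nm_ge0.
rewrite nm_iota -rmorphM (iota_le hK); have /andP[_ h] := hT x.
apply: le_trans h _; have Nx := norm_ge0 is_norm_rnorm x.
have hM y : `|f y| <= `|M| * rnorm y.
  apply: le_trans (hf y) _; rewrite ler_wpM2r ?ler_norm//.
  exact: norm_ge0 is_norm_rnorm y.
have Nj : rnorm (j *: (x : X)) = nm j * rnorm x.
  by apply: (fmorph_inj iota); rewrite rmorphM !iota_rnorm normrZ (iota_nm hK).
have := hM x; have := hM (j *: (x : X)); rewrite Nj; lra.
Qed.

(** The principle is applied to scalar-valued [T i] with [nm (T i x)] bounded by the values of [f i]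
    at [x] and [j *: x]; this transfers pointwise boundedness, and the conclusion comes back through
    [|f i x| <= nm (T i x)]. *)
Lemma ubp_functionals (U : set_system nat) : UltraFilter U ->
  uniform_boundedness_principle U X ->
  forall f : nat -> XR -> R, (forall i, blin rnorm (f i)) ->
  (forall x, exists M, U [set i | `|f i x| <= M]) ->
  exists M, U [set i | forall x, `|f i x| <= M * rnorm x].
Proof.
move=> hU ubp f bf pb; have PU : ProperFilter U := ultra_proper.
have ex_T i : exists T : {linear X -> K^o}, continuous T /\
    forall x, `|f i x| <= nm (T x) <= `|f i x| + `|f i (j *: (x : X))|.
  by have [T cT hT] := complexified_functional (bf i); exists T.
have [T hT] := choice ex_T.
have [|||W W0 UW] := ubp K^o T _ _ (ball (0 : K^o) 1).
- by move=> i; exact: (hT i).1.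
- move=> x V /nbhs_ballP[e /= e0 eV].
  have [M1 UM1] := pb x; have [M2 UM2] := pb (j *: (x : X)).
  have C0 : 0 < `|M1| + `|M2| + 1 by rewrite ltr_wpDl// addr_ge0.
  exists (e / iota (`|M1| + `|M2| + 1)); first by rewrite divr_gt0// iota_gt0.
  apply: filterS2 UM1 UM2 => i /= h1 h2; apply: eV; rewrite -ball_normE /= sub0r normrN.
  rewrite normrM ger0_norm ?divr_ge0 ?(ltW e0) ?iota_ge0 ?(ltW C0)//.
  rewrite mulrAC ltr_pdivrMr ?iota_gt0// ltr_pM2l// nm_iota iota_lt.
  have /andP[_] := (hT i).2 x; have := ler_norm M1; have := ler_norm M2; lra.
- exact: nbhsx_ballx.
have /nbhs_ballP[r /= r0 rW] := W0.
have rE := iota_nm_ge0 (ltW r0); pose s := nm r.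
have s0 : 0 < s by rewrite -iota_gt0 rE.
(* A non-zero [x] is rescaled to norm [s / 2], inside the open ball of radius [s]. *)
exists (2 / s); apply: filterS UW => i sub x.
have Nx := norm_ge0 is_norm_rnorm x.
have [? [lf _]] := bf i.
have [x0|x0] := eqVneq (rnorm x) 0.
  by rewrite (norm_eq0 is_norm_rnorm x0) (lin0 lf) (norm0 is_norm_rnorm) mulr0 normr0.
have {}Nx : 0 < rnorm x by rewrite lt_def x0.
pose c := s / (2 * rnorm x); have c0 : 0 < c by rewrite divr_gt0// mulr_gt0.
have : ball (0 : K^o) 1 (T i (iota c *: (x : X))).
  apply: sub; exists (iota c *: (x : X)) => //; apply: rW.
  rewrite -ball_normE /= sub0r normrN normrZ norm_iota -iota_rnorm -rmorphM -rE iota_lt.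
  rewrite ger0_norm ?(ltW c0)// /c -/s.
  have -> : s / (2 * rnorm x) * rnorm x = s / 2 by field.
  by rewrite ltr_pdivrMr// mulr_natr mulr2n ltrDl.
rewrite -ball_normE /= sub0r normrN linearZ /= normrM norm_iota nm_iota.
rewrite -rmorphM -(rmorph1 iota) iota_lt.
rewrite ger0_norm ?(ltW c0)// => lt1; have /andP[h _] := (hT i).2 x.
have : c * `|f i x| <= 1 by apply: le_trans (ltW lt1); rewrite ler_wpM2l// ltW.
rewrite -ler_pdivlMl// mulr1 => /le_trans; apply.
by rewrite /c invf_div mulrAC.
Qed.

Lemma normed_ubp_semi_selective (U : set_system nat) : UltraFilter U -> free_filter U ->
  ~ finite_dimensional X -> uniform_boundedness_principle U X -> semi_selective U.
Proof.
move=> hU fU fdX ubp; apply: (ubp_semi_selective is_norm_rnorm) => //.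
  exact: realified_infinite.
exact: ubp_functionals.
Qed.

End Transfer.

(** * The Banach space of bounded sequences *)

Section BoundedSequences.
Context (R : realType) (K : numFieldType) (iota : {rmorphism R -> K}) (nm : K -> R) (j : K).
Context (hK : scalar_structure iota nm j).

Definition bounded_sequence : {pred (nat -> K^o)} :=
  [pred u | `[< exists M : R, forall n, nm (u n) <= M >]].

Lemma bounded_sequence_submod : submod_closed bounded_sequence.
Proof.
split; first by apply/asboolP; exists 0 => n; rewrite (nm0 hK).
move=> a u v /asboolP[M uM] /asboolP[L vL]; apply/asboolP; exists (nm a * M + L) => n.
apply: le_trans (nmD hK _ _) _; rewrite lerD// (nmM hK).
by rewrite ler_wpM2l// (nm_ge0 hK).
Qed.

HB.instance Definition _ :=
  GRing.isSubmodClosed.Build K (nat -> K^o) bounded_sequence bounded_sequence_submod.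

(* The parameter makes the instances below, which rely on [hK], inferable. *)
Record linf_of (h : scalar_structure iota nm j) := Linf {
  linf_val : nat -> K^o ;
  linf_valP : linf_val \in bounded_sequence }.

Notation linf := (linf_of hK).

HB.instance Definition _ := [isSub of linf for @linf_val hK].
HB.instance Definition _ := [Choice of linf by <:].
HB.instance Definition _ := [SubChoice_isSubLmodule of linf by <:].

Implicit Types x y : linf.

Definition linf_sup x : R := sup [set nm (linf_val x n) | n in [set: nat]].

Lemma has_sup_linf x : has_sup [set nm (linf_val x n) | n in [set: nat]].
Proof.
split; first by exists (nm (linf_val x 0%N)), 0%N.
by have /asboolP[M hM] := linf_valP x; exists M => _ [n _ <-].
Qed.

Lemma le_linf_sup x n : nm (linf_val x n) <= linf_sup x.
Proof. by apply: ub_le_sup; [case: (has_sup_linf x)|exists n]. Qed.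

Lemma linf_sup_le x c : (forall n, nm (linf_val x n) <= c) -> linf_sup x <= c.
Proof. by move=> h; apply: ge_sup; [case: (has_sup_linf x)|move=> _ [n _ <-]]. Qed.

Lemma linf_sup_ge0 x : 0 <= linf_sup x.
Proof. exact: le_trans (nm_ge0 hK _) (le_linf_sup x 0). Qed.

Lemma linf_normD x y : iota (linf_sup (x + y)) <= iota (linf_sup x) + iota (linf_sup y).
Proof.
rewrite -rmorphD (iota_le hK); apply: linf_sup_le => n.
apply: le_trans (nmD hK _ _) _; apply: lerD; exact: le_linf_sup.
Qed.

Lemma linf_normZ (a : K) x : iota (linf_sup (a *: x)) = `|a| * iota (linf_sup x).
Proof.
rewrite (nm_iota hK) -rmorphM; congr (iota _).
have le b y : linf_sup (b *: y) <= nm b * linf_sup y.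
  apply: linf_sup_le => n; rewrite [linf_val _ _]/(b * linf_val y n) (nmM hK).
  by rewrite ler_wpM2l ?(nm_ge0 hK)// le_linf_sup.
have [->|a0] := eqVneq a 0.
  apply/eqP; rewrite eq_le le (nm0 hK) mul0r; exact: linf_sup_ge0.
apply/eqP; rewrite eq_le le /=.
have a0' : 0 < nm a.
  by rewrite -(iota_gt0 hK) -(nm_iota hK) normr_gt0.
rewrite -ler_pdivlMl//; apply: le_trans (_ : _ <= nm a^-1 * linf_sup (a *: x)) _.
  by have := le a^-1 (a *: x); rewrite scalerA mulVf// scale1r.
rewrite (_ : nm a^-1 = (nm a)^-1)//.
by apply: (fmorph_inj iota); rewrite fmorphV !(iota_nm hK) normfV.
Qed.

Lemma linf_norm_eq0 x : iota (linf_sup x) = 0 -> x = 0.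
Proof.
move=> /eqP; rewrite -(rmorph0 iota) (inj_eq (fmorph_inj iota)) => /eqP x0.
apply/val_inj/funext => n /=; apply/eqP; rewrite -normr_eq0 (nm_iota hK).
rewrite -(rmorph0 iota) (inj_eq (fmorph_inj iota)) eq_le (nm_ge0 hK) andbT.
by rewrite -[leRHS]x0 le_linf_sup.
Qed.

HB.instance Definition _ :=
  @Lmodule_isNormed.Build K linf _ linf_normD linf_normZ linf_norm_eq0.

Lemma linf_normE x : `|x| = iota (linf_sup x).
Proof. by []. Qed.

(** In the span of [n] vectors, [n + 1] unit sequences would satisfy a non-trivial linear relation,
    which evaluation at each coordinate refutes. *)
Lemma linf_infinite : ~ finite_dimensional linf.
Proof.
move=> [n [e he]].
have delta_bounded k : (fun m => (m == k)%:R : K^o) \in bounded_sequence.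
  apply/asboolP; exists 1 => m; rewrite -(iota_le hK) (iota_nm hK) rmorph1 normr_nat.
  by case: (m == k); rewrite ?ler01.
pose delta k : linf := Linf hK (delta_bounded k).
have [c hc] := choice (fun k : 'I_n.+1 => he (delta k)).
pose C : 'M[K]_(n.+1, n) := \matrix_(k, i) c k i.
have kC : kermx C != 0.
  by rewrite -mxrank_eq0 mxrank_ker subn_eq0 -ltnNge ltnS rank_leq_col.
have /rowV0Pn[v /sub_kermxP vC v0] := kC.
have sum0 : \sum_(k < n.+1) v 0 k *: delta k = 0.
  under eq_bigr do rewrite hc scaler_sumr.
  rewrite exchange_big /= big1// => i _.
  under eq_bigr do rewrite scalerA.
  rewrite -scaler_suml (_ : \sum_k _ = 0) ?scale0r//.
  have := congr1 (fun B : 'rV_n => B 0 i) vC; rewrite !mxE => h.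
  by rewrite -[RHS]h; apply: eq_bigr => k _; rewrite mxE.
move/eqP : v0; apply; apply/rowP => k; rewrite mxE.
have := congr1 (fun x => linf_val x k) sum0.
rewrite (big_morph (fun x => linf_val x k) (id1 := 0) (op1 := +%R))// (bigD1 k)//= big1 => [|l lk].
  change (v 0 k * (k == k :> nat)%:R + 0 = 0 -> v 0 k = 0).
  by rewrite eqxx mulr1 addr0.
change (v 0 l * (k == l :> nat)%:R = 0).
rewrite (_ : (k == l :> nat) = false) ?mulr0//.
by apply/negP => /eqP e'; move/eqP : lk; apply; apply/val_inj.
Qed.

Lemma linf_cauchy (u : nat -> linf) :
  (forall e : R, 0 < e -> exists n, forall k l, (n <= k)%N -> (n <= l)%N ->
    linf_sup (u k - u l) < e) ->
  exists v, forall e : R, 0 < e -> exists n, forall k, (n <= k)%N -> linf_sup (u k - v) <= e.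
Proof.
move=> cu.
have valB x y n : linf_val (x - y) n = linf_val x n - linf_val y n by [].
have ex_v n : exists v, forall e, 0 < e -> exists m, forall k, (m <= k)%N ->
    nm (linf_val (u k) n - v) < e.
  apply: (scalar_complete hK (u := fun k => linf_val (u k) n)) => e e0.
  have [m hm] := cu e e0; exists m => k l mk ml; apply: le_lt_trans (hm k l mk ml).
  by rewrite -valB le_linf_sup.
have [v hv] := choice ex_v.
have close e : 0 < e -> exists m, forall k, (m <= k)%N ->
    forall n, nm (linf_val (u k) n - v n) <= e.
  move=> e0; have e2 : 0 < e / 2 by rewrite divr_gt0.
  have [m hm] := cu _ e2; exists m => k mk n; have [m' hm'] := hv n _ e2.
  have h1 := hm k (maxn m m') mk (leq_maxl _ _); have h2 := hm' _ (leq_maxr m m').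
  rewrite -(subrK (linf_val (u (maxn m m')) n) (linf_val (u k) n)) -addrA.
  apply: le_trans (nmD hK _ _) _; have := le_linf_sup (u k - u (maxn m m')) n.
  by rewrite valB; lra.
have bv : (v : nat -> K^o) \in bounded_sequence.
  have [m hm] := close 1 ltr01; apply/asboolP; exists (1 + linf_sup (u m)) => n.
  rewrite -(subrK (linf_val (u m) n) (v n)); apply: le_trans (nmD hK _ _) _.
  apply: lerD; last exact: le_linf_sup.
  have := hm m (leqnn m) n; rewrite -(iota_le hK) -[nm (v n - _) <= 1](iota_le hK).
  by rewrite !(iota_nm hK) distrC.
exists (Linf hK bv) => e e0; have [m hm] := close e e0; exists m => k mk.
by apply: linf_sup_le => n; exact: hm.
Qed.

(** Makes bounded sequences an infinite-dimensional test space: a UBP filter satisfies the principle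
    on it, which already forces semi-selectivity. *)
Lemma linf_frechet : @frechet K linf.
Proof.
exists (fun x y : linf => `|x - y|); split.
- by move=> x y.
- move=> x y; split=> [/eqP|->]; last by rewrite subrr normr0.
  by rewrite normr_eq0 subr_eq0 => /eqP.
- by move=> x y; rewrite distrC.
- by move=> x y z; exact: ler_distD.
- by move=> x y z; rewrite opprD addrACA subrr addr0.
- move=> x A; split=> [/nbhs_ballP[e e0 eA]|[e e0 eA]].
    by exists e => // y xy; apply: eA; rewrite -ball_normE.
  by apply/nbhs_ballP; exists e => // y; rewrite -ball_normE; exact: eA.
- move=> u cu; have [|v hv] := @linf_cauchy u.
    move=> e e0; have [|m hm] := cu (iota e); first by rewrite (iota_gt0 hK).
    by exists m => k l mk ml; have := hm k l mk ml; rewrite linf_normE (iota_lt hK).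
  exists v; apply/cvgrPdist_le => e e0.
  have e0' : 0 < nm e by rewrite -(iota_gt0 hK) (iota_nm_ge0 hK)// ltW.
  have [m hm] := hv _ e0'; exists m => // k mk /=.
  by rewrite distrC linf_normE -(iota_nm_ge0 hK (ltW e0)) (iota_le hK); exact: hm.
Qed.

End BoundedSequences.

Theorem corollary5p1 (R : realType) (K : numFieldType)
    (hK : scalar_field R K) :
  (forall U : set_system nat, UltraFilter U -> free_filter U ->
     (UBP_filter K U <-> semi_selective U)) /\
  (forall U : set_system nat, UltraFilter U -> free_filter U ->
     (exists X : completeNormedModType K,
        ~ finite_dimensional X /\ uniform_boundedness_principle U X) ->
     semi_selective U).
Proof.
have [iota [nm [j sK]]] := scalar_fieldP hK; split=> U hU fU.
  split=> [ubp|ssU X [d hd] Y T cT].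
    apply: (normed_ubp_semi_selective sK hU fU (linf_infinite (hK := sK))).
    exact/ubp/linf_frechet.
  exact: (semi_selective_equicontinuous (scalar_archimedean sK) hd cT ssU).
by move=> [X [fdX ubp]]; exact: (normed_ubp_semi_selective sK hU fU fdX ubp).
Qed.
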